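(* Suppose that the stochastic dynamical system $(X_n^x)$ on the proper metric space $\mathsf X$ is locally contractive and recurrent, and let $\nu$ be an invariant Radon measure for it. Then the shift $T$ on the trajectory space $\mathsf X^{\mathbb N_0}$ is ergodic with respect to $\mathrm{Pr}_\nu$. In particular, $\nu$ is the unique invariant Radon measure for the stochastic dynamical system up to multiplication with constants.
   Context: Let $(\mathsf X,d)$ be a proper metric space (closed balls are compact), and let $\mathfrak G$ be the monoid of all continuous maps $\mathsf X\to\mathsf X$ with the topology of uniform convergence on compact sets. Let $\tilde\mu$ be a regular probability measure on $\mathfrak G$ and $(F_n)_{n\ge1}$ i.i.d. $\mathfrak G$-valued random variables with distribution $\tilde\mu$, defined on a probability space $(\Omega,\mathfrak A,\mathrm{Pr})$. The stochastic dynamical system (SDS) is $X_0^x=x\in\mathsf X$, $X_n^x=F_n(X_{n-1}^x)$, $n\ge1$. It is a Markov chain with transition kernel $P(x,U)=\mathrm{Pr}[X_1^x\in U]$. The SDS is locally contractive if for every $x\in\mathsf X$ and every compact $K\subset\mathsf X$, $\mathrm{Pr}[d(X_n^x,X_n^y)\,\mathbf 1_K(X_n^x)\to0 \text{ for all } y\in\mathsf X]=1$. A locally contractive SDS is called recurrent if $\mathrm{Pr}[d(X_n^x,x)\to\infty]=0$ for all $x$; in this case there is a deterministic non-empty closed set $\mathsf L\subset\mathsf X$ (the attractor, or limit set) such that with probability 1, for all $x\in\mathsf X$ the set of accumulation points of $(X_n^x)_{n\ge 0}$ is $\mathsf L$. A recurrent locally contractive SDS possesses an invariant Radon measure, i.e.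 a non-zero Radon measure $\nu$ on $\mathsf X$ with $\nu(U)=\int_{\mathsf X}\mathrm{Pr}[X_1^x\in U]\,d\nu(x)$ for all Borel sets $U$; it has support $\mathsf L$. $\mathrm{Pr}_x$ is the distribution of $(X_n^x)_{n\ge0}$ on $\mathsf X^{\mathbb N_0}$ (product Borel $\sigma$-algebra), $\mathrm{Pr}_\nu=\int_{\mathsf L}\mathrm{Pr}_x\,d\nu(x)$ (a $\sigma$-finite measure), and $T$ is the time shift $T(x_0,x_1,\dots)=(x_1,x_2,\dots)$. *)

(* Defs.v *)
From HB Require Import structures.
From mathcomp Require Import all_boot all_order all_algebra finmap.
From mathcomp Require Import all_classical all_reals all_analysis.

Set Implicit Arguments.
Unset Strict Implicit.
Unset Printing Implicit Defensive.

Import Order.TTheory GRing.Theory Num.Theory.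
Import numFieldTopology.Exports.

Local Open Scope classical_set_scope.
Local Open Scope ring_scope.

(* Measurable types are pointed in the library, hence so must be the state
   space. This is no restriction here: the empty space carries no non-zero
   measure. *)
#[short(type="pmetricType")]
HB.structure Definition PointedMetric (K : numDomainType) :=
  {M of Metric K M & Pointed M}.

Notation borel T := (g_sigma_algebraType (@open T)).

Definition proper_metric (R : realType) (X : metricType R) : Prop :=
  forall (x : X) (r : R), compact [set y | mdist x y <= r].

(* Continuous self-maps, with the topology of uniform convergence on compact
   sets. *)
Definition cmap (R : realType) (X : pmetricType R) : Type :=
  initial_topology
    (fun f : continuousType X X => (f : X -> X) : {family compact, X -> X}).

HB.instance Definition _ (R : realType) (X : pmetricType R) :=
  Topological.on (cmap X).
HB.instance Definition _ (R : realType) (X : pmetricType R) :=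
  isPointed.Build (cmap X) (idfun : continuousType X X).

Definition cmap_eval (R : realType) (X : pmetricType R) (f : cmap X) (x : X) :
  X := (f : continuousType X X) x.

Section borel_measures.
Context (R : realType) (T : ptopologicalType).
Implicit Type m : set (borel T) -> \bar R.

Definition inner_regular m : Prop :=
  forall A : set (borel T), measurable A ->
    m A = ereal_sup [set m K | K in [set K : set T | compact K /\ K `<=` A]].

Definition outer_regular m : Prop :=
  forall A : set (borel T), measurable A ->
    m A = ereal_inf [set m U | U in [set U : set T | open U /\ A `<=` U]].

Definition regular_measure m : Prop := inner_regular m /\ outer_regular m.

Definition radon_measure m : Prop :=
  (forall K : set T, compact K -> (m K < +oo)%E) /\ inner_regular m.

End borel_measures.

Definition mutually_independent (R : realType) (d : measure_display)
    (Omega : measurableType d) (P : probability Omega R)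
    (d' : measure_display) (T : measurableType d') (F : nat -> Omega -> T) :
    Prop :=
  forall (J : {fset nat}) (B : nat -> set T), (forall n, measurable (B n)) ->
    P (\bigcap_(n in [set` J]) (F n @^-1` B n)) =
    (\prod_(n <- J) P (F n @^-1` B n))%E.

Definition iid_with_law (R : realType) (d : measure_display)
    (Omega : measurableType d) (P : probability Omega R)
    (d' : measure_display) (T : measurableType d') (mu : probability T R)
    (F : nat -> {RV P >-> T}) : Prop :=
  mutually_independent P (fun n => F n : Omega -> T) /\
  forall n (B : set T), measurable B -> distribution P (F n) B = mu B.

Definition ergodic (R : realType) (d : measure_display) (T : measurableType d)
    (m : set T -> \bar R) (f : T -> T) : Prop :=
  forall A : set T, measurable A -> f @^-1` A = A ->
    m A = 0%E \/ m (~` A) = 0%E.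

(* Generators of the product Borel sigma-algebra on the trajectory space. *)
Definition cylinders (R : realType) (X : pmetricType R) : set (set (nat -> X)) :=
  [set C | exists n (B : set (borel X)),
     measurable B /\ C = [set t : nat -> X | B (t n)]].

Notation trajectories X := (g_sigma_algebraType (@cylinders _ X)).

Definition time_shift (R : realType) (X : pmetricType R) (t : trajectories X) :
  trajectories X := fun n => t n.+1.

Section sds.
Context (R : realType) (X : pmetricType R) (d : measure_display)
  (Omega : measurableType d) (P : probability Omega R)
  (F : nat -> Omega -> borel (cmap X)).

(* The maps are indexed from 0: [F n] is the (n+1)-st map applied. *)
Fixpoint sds (x : X) (n : nat) (w : Omega) : X :=
  if n is m.+1 then cmap_eval (F m w) (sds x m w) else x.

Definition transition (x : X) (U : set (borel X)) : \bar R :=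
  P [set w | U (sds x 1 w)].

(* "{ae P, _}" means that the complement of the event is contained in a
   measurable null set; the event itself is an uncountable intersection. *)
Definition locally_contractive : Prop :=
  forall (x : X) (K : set X), compact K ->
    {ae P, forall w, forall y : X,
      mdist (sds x n w) (sds y n w) * \1_K (sds x n w) @[n --> \oo] --> (0 : R)}.

Definition recurrent : Prop :=
  forall x : X, P [set w | mdist (sds x n w) x @[n --> \oo] --> +oo%R] = 0%E.

Definition is_attractor (L : set X) : Prop :=
  [/\ closed L, L !=set0 &
      {ae P, forall w, forall x : X, cluster (sds x n w @[n --> \oo]) = L}].

Definition invariant_radon_measure (nu : {measure set (borel X) -> \bar R}) :
    Prop :=
  [/\ radon_measure nu, nu setT != 0%E &
      forall U : set (borel X), measurable U ->
        nu U = (\int[nu]_x transition x U)%E].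

Definition trajectory (x : X) (w : Omega) : trajectories X :=
  fun n => sds x n w.

Definition Pr_from (x : X) : set (trajectories X) -> \bar R :=
  pushforward P (trajectory x).

Definition Pr_initial (nu : {measure set (borel X) -> \bar R}) (L : set X)
    (A : set (trajectories X)) : \bar R :=
  (\int[nu]_(x in L) Pr_from x A)%E.

End sds.

(* Main.v *)
(* Contraction makes discounted sums forget their starting point. For continuous
   [0 <= phi <= psi <= 1] supported in a ball and a small [lam > 0], kill the
   trajectory at each step with probability [lam * psi (X_n)] and let [J(x)] be
   [sum_n lam phi(X_n) prod_(k < n) (1 - lam psi(X_k))] along the trajectory from
   [x]. For every invariant measure [nu], shifting time gives
   [int psi(x) E J(x) nu(dx) = int phi dnu]; here Poincare recurrence ensures that
   almost no trajectory starting where [psi > 0] survives for ever. A resolvent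
   identity bounds [|J(x) - J(y)|] by the discounted sum of the discrepancies of
   [phi] and [psi] along the two trajectories, which by local contractivity are
   eventually at most [eps] and occur only while [X_n^x] is in a ball; its
   integral against [psi dnu] is [O(eps) + o(1)] as [lam -> 0]. Hence
   [E J(y) -> int phi dnu / int psi dnu] for an arbitrary [y], so that this ratio
   does not depend on [nu]: this is uniqueness.

   If [A] is shift invariant and [h(x) = Pr_x(A)], then [h] is bounded and
   harmonic, so [E sum_n (h(X_(n+1)) - h(X_n))^2 <= 1], and recurrence forces
   [h(X_1) = h(X_0)] almost surely. Therefore [h dnu] is invariant, hence equal to
   [c dnu], which makes [A] independent of all cylinders, and then of itself:
   [c = c^2]. *)
Require Import Defs.
From HB Require Import structures.
From mathcomp Require Import all_boot all_order all_algebra finmap.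
From mathcomp Require Import all_classical all_reals all_analysis.
From mathcomp Require Import measurable_realfun ring lra zify.

Set Implicit Arguments.
Unset Strict Implicit.
Unset Printing Implicit Defensive.

Import Order.TTheory GRing.Theory Num.Theory.
Import numFieldTopology.Exports.

Local Open Scope classical_set_scope.
Local Open Scope ring_scope.

(** The measure [nu] may be infinite, so time averages carry no information, and local contractivity
    gives no rate and says nothing while the trajectory is far away. The discounting answers both
    points. As [phi <= psi], the sum [J] stays between [0] and [1] however long the trajectory is,
    so an exceptional event of small measure costs little; and any fixed number [N0] of early times,
    where the two trajectories are not yet close, costs only [O(lam N0)]. The parameters are
    therefore chosen in the order [eps], [N0], [lam], and the horizon [N] comes last. The remaining
    error is summed over an unbounded time. It is controlled because invariance of [nu] bounds the
    discounted visits to a ball by the measure of that ball, uniformly in [lam] and [N]. For this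
    the error must be discounted along the trajectory from [x], whose law is stationary, and not
    along the one from the fixed point [y]. In the second half [h] is only known to be measurable,
    so contractivity cannot be applied to it directly; a martingale argument with conservativity
    takes its place. *)

Local Notation pushforward_measure :=
  measure_function_pushforward__canonical__measure_function_Measure.

(** * Proper metric spaces and continuous maps *)

Section proper_space.
Context (R : realType) (X : pmetricType R).
Implicit Types (x y z : X) (r e : R) (U K : set X).

Lemma open_mball x r : open [set y | mdist x y < r].
Proof.
rewrite openE => y /= xyr; apply/nbhs_ballP; exists (r - mdist x y) => /=.
  by rewrite subr_gt0.
move=> z; rewrite ballEmdist /= => yz.
by rewrite (le_lt_trans (metric_triangle x y z))// -ltrBrDl.
Qed.

Lemma closed_mball x r : closed [set y | mdist x y <= r].
Proof.
rewrite (_ : [set y | _] = ~` [set y | r < mdist x y]); last first.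
  by apply/seteqP; split=> y /=; [rewrite leNgt => /negP|move/negP; rewrite -leNgt].
rewrite closedC openE => y /= ryx; apply/nbhs_ballP.
exists (mdist x y - r) => /=; first by rewrite subr_gt0.
move=> z; rewrite ballEmdist /= => yz.
have := metric_triangle x z y; rewrite (metric_sym z y) => h.
by rewrite -(ltrD2r (mdist y z)) (lt_le_trans _ h)// -ltrBrDl.
Qed.

(** Its complement is the union of the balls of radius [r] about the points outside [U]. Closedness
    lets a condition tested along a dense sequence pass to the limit. *)
Lemma closed_ball_inside U r : closed [set z | [set y | mdist z y < r] `<=` U].
Proof.
rewrite (_ : [set z | _] = ~` \bigcup_(u in ~` U) [set z | mdist u z < r]).
  by rewrite closedC; apply: bigcup_open => u _; exact: open_mball.
apply/seteqP; split=> [z zU [u nUu /= uzr]|z + y /= zyr].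
  by apply: nUu; apply: zU => /=; rewrite metric_sym.
by apply: contra_notP => nUy; exists y => //=; rewrite metric_sym.
Qed.

Hypothesis hX : proper_metric X.

(** By properness the ball of radius [n] about [point] has a finite net of mesh [1/(m+1)]. The
    points of all these nets are enumerated by the codes of triples [(n, m, i)]; other codes give
    [point]. *)
Lemma dense_sequence : exists q : nat -> X,
  forall x e, 0 < e -> exists i, mdist (q i) x < e.
Proof.
have cov (nm : nat * nat) : exists s : seq X, forall x,
    mdist point x <= nm.1%:R -> exists2 c, c \in s & mdist c x < nm.2.+1%:R^-1.
  have := @hX point (nm.1%:R); rewrite compact_cover.
  move=> /(_ X setT (fun c => [set y | mdist c y < nm.2.+1%:R^-1])) [].
  - by move=> c _; exact: open_mball.
  - by move=> x _; exists x => //=; rewrite mdistxx invr_gt0.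
  - move=> D _ DK; exists D => x /DK[c /= cD cx]; by exists c.
have [s sP] := choice cov.
pose q (k : nat) : X :=
  if (choice.unpickle k : option (nat * nat * nat)) is Some (n, m, i)
  then nth point (s (n, m)) i else point.
exists q => x e e0.
have [m _ /(_ m (leqnn m))/= me] := near_infty_natSinv_lt (PosNum e0).
pose n := (Num.truncn (mdist point x)).+1.
have /(sP (n, m))[c cs cx] : mdist point x <= n%:R.
  by rewrite ltW// truncnS_gt.
exists (choice.pickle (n, m, index c (s (n, m)))).
by rewrite /q choice.pickleK nth_index//= (lt_trans cx).
Qed.

Lemma measurable_open U : open U -> measurable (U : set (borel X)).
Proof. exact: sub_sigma_algebra. Qed.

Lemma measurable_closed U : closed U -> measurable (U : set (borel X)).
Proof.
move=> cU; rewrite -(setCK U); apply: (@measurableC _ (borel X)).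
by apply: sub_sigma_algebra; exact: closed_openC.
Qed.

(** Uniform convergence on compact sets implies pointwise convergence. *)
Lemma cmap_eval_continuous x : continuous (fun f : cmap X => cmap_eval f x).
Proof.
move=> f.
pose g (h : cmap X) : {family compact, X -> X} := (h : continuousType X X).
have cg : {for f, continuous g} by exact: initial_continuous.
have Fg : Filter (g @ nbhs f) by exact: fmap_filter.
have /(pointwise_cvgP _ Fg) := pointwise_cvg_compact_family Fg cg.
exact.
Qed.

Lemma measurable_cmap_eval_at x :
  measurable_fun setT (fun f : borel (cmap X) => cmap_eval f x : borel X).
Proof.
apply: (@measurability _ _ _ (borel X) _ _ (@open X)) => // _ [U oU <-]; rewrite setTI.
apply: sub_sigma_algebra; apply: open_comp => // f _; exact: cmap_eval_continuous.
Qed.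

Lemma cmap_continuous (f : cmap X) : continuous (cmap_eval f).
Proof. exact: (@cts_fun _ _ (f : continuousType X X)). Qed.

(* Caratheodory: [f x] lies in the open set [U] iff for some [k] and [m] every
   point of the dense sequence within [1/m] of [x] is sent by [f] to the closed
   set of points whose [1/k]-ball is inside [U]. *)
Lemma measurable_cmap_eval : measurable_fun setT
  (fun p : borel (cmap X) * borel X => cmap_eval p.1 p.2 : borel X).
Proof.
have [q qP] := dense_sequence.
apply: (@measurability _ _ _ (borel X) _ _ (@open X)) => // _ [U oU <-]; rewrite setTI.
pose C k := [set z : X | [set y | mdist z y < k.+1%:R^-1] `<=` U].
have -> : (fun p : cmap X * X => cmap_eval p.1 p.2) @^-1` U =
  \bigcup_k \bigcup_m \bigcap_i
    ((~` (snd @^-1` [set x | mdist (q i) x < m.+1%:R^-1])) `|`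
     (fst @^-1` ((fun f : cmap X => cmap_eval f (q i)) @^-1` C k))).
  apply/seteqP; split=> [[f x]/= Ufx|[f x] [k _ [m _ h]]/=].
    have : nbhs (cmap_eval f x) U by exact: open_nbhs_nbhs.
    move=> /nbhs_ballP[e /= e0]; rewrite ballEmdist => eU.
    have e20 : 0 < e / 2 by rewrite divr_gt0.
    have [k _ /(_ k (leqnn k))/= ke] := near_infty_natSinv_lt (PosNum e20).
    have /(_ _ (nbhsx_ballx _ _ e20)) := @cmap_continuous f x.
    move=> /nbhs_ballP[d /= d0]; rewrite !ballEmdist => df.
    have [m _ /(_ m (leqnn m))/= md] := near_infty_natSinv_lt (PosNum d0).
    exists k => //; exists m => // i _.
    have [qix|] := boolP (mdist (q i) x < m.+1%:R^-1); last by move/negP; left.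
    right => y /= qiy; apply: eU => /=.
    rewrite (le_lt_trans (metric_triangle _ (cmap_eval f (q i)) _))//.
    rewrite [e]splitr ltrD//.
      by apply: df => /=; rewrite metric_sym (lt_trans qix).
    exact: lt_trans qiy ke.
  suff : C k (cmap_eval f x).
    by apply => /=; rewrite mdistxx.
  have /closure_id -> : closed (C k) by exact: closed_ball_inside.
  move=> B /(@cmap_continuous f x) /nbhs_ballP[d /= d0]; rewrite ballEmdist => dB.
  (* The minimum serves two purposes: [q i] is close enough to [x] for [h] to place [f (q i)] in
     [C k], and for [f (q i)] to lie in [B]. *)
  have dm0 : 0 < Num.min d m.+1%:R^-1 by rewrite lt_min d0 invr_gt0/=.
  have [i qix] := qP x _ dm0.
  move: qix; rewrite lt_min => /andP[qid qim].
  exists (cmap_eval f (q i)); split; last by apply: dB => /=; rewrite metric_sym.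
  by case: (h i I).
apply: bigcupT_measurable => k; apply: bigcupT_measurable => m.
apply: bigcapT_measurable => i; apply: measurableU.
  apply: measurableC; rewrite -[X in measurable X]setTI; apply: measurable_snd => //.
  by apply: measurable_open; exact: open_mball.
rewrite -[X in measurable X]setTI; apply: measurable_fst => //.
rewrite -[X in measurable X]setTI; apply: measurable_cmap_eval_at => //.
by apply: measurable_closed; exact: closed_ball_inside.
Qed.

End proper_space.

(** * Sequence spaces *)

Section sequence_space.
Context (d : measure_display) (T : measurableType d).

Definition coordinate_cylinders : set (set (nat -> T)) :=
  [set C | exists n (B : set T), measurable B /\ C = [set t : nat -> T | B (t n)]].

Notation seqspace := (g_sigma_algebraType coordinate_cylinders).

Lemma measurable_coordinate n : measurable_fun setT (fun t : seqspace => t n).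
Proof.
move=> _ B mB; rewrite setTI; apply: sub_sigma_algebra.
by exists n, B.
Qed.

Lemma measurable_to_seqspace (d' : measure_display) (U : measurableType d')
    (f : U -> seqspace) :
  (forall n, measurable_fun setT (fun u => f u n)) -> measurable_fun setT f.
Proof.
move=> mf.
apply: (@measurability _ _ _ seqspace _ _ coordinate_cylinders) => //.
move=> _ [_ [n [B [mB ->]]] <-]; rewrite setTI.
by have := mf n measurableT B mB; rewrite setTI.
Qed.

(** The bound is inclusive: [n.+1] coordinates are constrained. Unlike cylinders over one
    coordinate, boxes are stable under intersection. *)
Definition box n (B : nat -> set T) : set (nat -> T) :=
  [set t | forall k, (k <= n)%N -> B k (t k)].

Lemma measurable_box n B : (forall k, measurable (B k)) ->
  measurable (box n B : set seqspace).
Proof.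
move=> mB.
have -> : box n B =
    \bigcap_k (if (k <= n)%N then [set t : seqspace | B k (t k)] else setT).
  apply/seteqP; split=> [t tB k _|t tB k kn]; first by case: ifPn => // kn; exact: tB.
  by have := tB k I; rewrite kn.
apply: bigcapT_measurable => k; case: ifPn => // _.
by have := measurable_coordinate k measurableT (mB k); rewrite setTI.
Qed.

(** Boxes form a pi-system generating the product sigma-algebra. The measures may be infinite: the
    sets [b k], imposed on coordinate [0], exhaust the space by sets of finite measure. *)
Lemma seqspace_measure_unique (R : realType)
    (m1 m2 : {measure set seqspace -> \bar R}) (b : nat -> set T) :
  (forall k, measurable (b k)) -> \bigcup_k b k = setT ->
  (forall k, (m1 [set t | b k (t 0%N)] < +oo)%E) ->
  (forall n B, (forall k, measurable (B k)) -> m1 (box n B) = m2 (box n B)) ->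
  forall A, measurable A -> m1 A = m2 A.
Proof.
move=> mb bT boo m12.
pose G : set (set seqspace) :=
  [set C | exists n B, (forall k, measurable (B k)) /\ C = box n B].
pose g k : set seqspace := [set t | b k (t 0%N)].
have gE k : g k = box 0 (fun=> b k).
  by apply/seteqP; split=> [t tb [|j]//|t]; exact.
apply: (@measure_unique _ R seqspace G g).
- apply/seteqP; split; apply: smallest_sub; try exact: smallest_sigma_algebra.
    move=> _ [n [B [mB ->]]]; apply: sub_sigma_algebra.
    exists n, (fun k => if k == n then B else setT); split.
      by move=> k; case: ifPn.
    apply/seteqP; split=> [t tB k kn|t /(_ n (leqnn n))]; last by rewrite eqxx.
    by case: ifPn => // /eqP ->.
  by move=> _ [n [B [mB ->]]]; exact: measurable_box.
- move=> _ _ [n1 [B1 [mB1 ->]]] [n2 [B2 [mB2 ->]]].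
  (* Both boxes are brought to the same length by trivial constraints. *)
  exists (maxn n1 n2), (fun k => (if (k <= n1)%N then B1 k else setT) `&`
    (if (k <= n2)%N then B2 k else setT)); split.
    by move=> k; apply: measurableI; case: ifPn.
  apply/seteqP; split=> [t [t1 t2] k _|t tB].
    by split; case: ifPn => // h; [exact: t1|exact: t2].
  split=> k kn.
    by have /(_ _)[] := tB k; rewrite ?leq_max kn.
  by have /(_ _)[] := tB k; rewrite ?leq_max kn ?orbT.
- by move=> k; exists 0%N, (fun=> b k); split => //; rewrite gE.
- rewrite -subTset => t _; have : setT (t 0%N) by [].
  by rewrite -bT => -[k _ bk]; exists k.
- by move=> _ [n [B [mB ->]]]; exact: m12.
- exact: boo.
Qed.

End sequence_space.
Notation seqspace T := (g_sigma_algebraType (@coordinate_cylinders _ T)).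

(** * Orbits driven by a sequence of maps *)

Section orbits.
Context (R : realType) (X : pmetricType R).
Hypothesis hX : proper_metric X.

(** The recursion of [sds] with the maps read from a sequence: a trajectory becomes a function of
    its starting point and of the i.i.d. sequence alone. *)
Fixpoint cmap_orbit (s : nat -> cmap X) (x : X) n : X :=
  if n is m.+1 then cmap_eval (s m) (cmap_orbit s x m) else x.

(** The recursion peels off the last map; the Markov property requires splitting off the first. *)
Lemma cmap_orbitS s x n :
  cmap_orbit s x n.+1 = cmap_orbit (fun k => s k.+1) (cmap_eval (s 0%N) x) n.
Proof. by elim: n => //= n <-. Qed.

Lemma measurable_cmap_orbit n : measurable_fun setT
  (fun p : borel X * seqspace (borel (cmap X)) => cmap_orbit p.2 p.1 n : borel X).
Proof.
elim: n => [|n IHn] /=; first exact: measurable_fst.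
have : measurable_fun setT (fun p : borel X * seqspace (borel (cmap X)) =>
    (p.2 n : borel (cmap X), cmap_orbit p.2 p.1 n : borel X)).
  apply: measurable_fun_pair => //.
  apply: (measurableT_comp (measurable_coordinate n)).
  exact: measurable_snd.
exact: (measurableT_comp (measurable_cmap_eval hX)).
Qed.

Lemma measurable_path : measurable_fun setT
  (fun p : borel X * seqspace (borel (cmap X)) =>
     (fun n => cmap_orbit p.2 p.1 n) : trajectories X).
Proof.
apply: (@measurable_to_seqspace _ (borel X)) => n; exact: measurable_cmap_orbit.
Qed.

End orbits.

(** * Stationarity and independence of the sequence of maps *)

Section iid_sequence.
Context (R : realType) (d : measure_display) (Omega : measurableType d)
  (P : probability Omega R) (d' : measure_display) (T : measurableType d')
  (mu : probability T R) (F : nat -> {RV P >-> T}).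
Hypothesis hF : iid_with_law mu F.

Definition sample_fun m (w : Omega) : seqspace T := fun k => F (m + k)%N w.

Lemma measurable_sample m : measurable_fun setT (sample_fun m).
Proof. by apply: measurable_to_seqspace => n; exact: measurable_funPT. Qed.

HB.instance Definition _ m :=
  isMeasurableFun.Build _ _ _ _ (sample_fun m) (measurable_sample m).

Definition sample m : {RV P >-> seqspace T} := sample_fun m.

(** The right-hand side is free of [m]: dropping the first maps does not change the law of the
    sequence. *)
Lemma iid_box m n (B : nat -> set T) : (forall k, measurable (B k)) ->
  distribution P (sample m) (box n B) = (\prod_(k < n.+1) mu (B k))%E.
Proof.
move=> mB; have [ind law] := hF.
change (distribution P (sample m) (box n B))
  with (P [set w | forall k, (k <= n)%N -> B k (F (m + k)%N w)]).
pose J := [fset (m + k)%N | k in iota 0 n.+1]%fset.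
have JE k : (k \in J) = (m <= k <= m + n)%N.
  apply/imfsetP/idP => [[j]|/andP[mk kmn]].
    move=> jn ->; have : j \in iota 0 n.+1 by [].
    by rewrite mem_iota ltnS leq_addr leq_add2l => /andP[].
  exists (k - m)%N; last by rewrite subnKC.
  by have := mem_iota 0 n.+1 (k - m)%N; rewrite leq0n ltnS leq_subLR kmn.
(* Independence is stated at absolute times, so [B k] is attached to the time [m + k]; on [J] the
   truncated subtraction is exact. *)
have := ind J (fun k => B (k - m)%N) (fun k => mB _).
have -> : \bigcap_(k in [set` J]) F k @^-1` B (k - m)%N =
    [set w | forall k, (k <= n)%N -> B k (F (m + k)%N w)].
  apply/seteqP; split=> [w h k kn|w h k /=].
    by have := h (m + k)%N; rewrite /= JE leq_addr leq_add2l kn addKn; exact.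
  rewrite JE => /andP[mk kmn]; have := h (k - m)%N.
  by rewrite subnKC// leq_subLR; exact.
move=> ->.
have -> : (\prod_(k <- J) P (F k @^-1` B (k - m)%N) =
    \prod_(k <- [seq (m + j)%N | j <- iota 0 n.+1]) P (F k @^-1` B (k - m)%N))%E.
  apply: perm_big; apply: uniq_perm; first exact: fset_uniq.
    by rewrite map_inj_uniq ?iota_uniq//; exact: addnI.
  by move=> k; apply/imfsetP/mapP => -[j jn ->]; exists j.
rewrite big_map -[in LHS](subn0 n.+1) -/(index_iota 0 n.+1) big_mkord.
by apply: eq_bigr => k _; rewrite addKn; exact: law.
Qed.

(** The first map and the rest are independent, and the rest has the law of the whole sequence, so
    [w'] plays the part of an independent copy. Equivalently, prepending an independent map to the
    sequence leaves its law unchanged; this is checked on boxes. *)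
Lemma split_sample_law (C : set (T * seqspace T)) : measurable C ->
  P [set w | C (F 0%N w, sample 1 w)] =
  (\int[P]_w P [set w' | C (F 0%N w, sample 0 w')])%E.
Proof.
move=> mC.
pose cons_seq (p : T * seqspace T) : seqspace T :=
  fun k => if k is j.+1 then p.2 j else p.1.
have mcons : measurable_fun setT cons_seq.
  apply: measurable_to_seqspace => -[|k]; first exact: measurable_fst.
  exact: measurableT_comp (measurable_coordinate k) measurable_snd.
have mshift : measurable_fun setT
    (fun t : seqspace T => (t 0%N, fun k => t k.+1) : T * seqspace T).
  apply: measurable_fun_pair; first exact: measurable_coordinate.
  by apply: measurable_to_seqspace => n; exact: measurable_coordinate.
pose m1 : {measure set (T * seqspace T) -> \bar R} :=
  (distribution P (F 0%N) \x distribution P (sample 0))%E.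
pose m2 := pushforward_measure m1 mcons.
have m2E : forall A, measurable A -> distribution P (sample 0) A = m2 A.
  apply: (@seqspace_measure_unique _ T R _ _ (fun=> setT)) => //.
  - by rewrite bigcup_const.
  - by move=> _; rewrite ltey_eq (fin_num_measure _ _ (@measurableT _ (seqspace T))).
  - move=> n B mB; rewrite /m2 /= /pushforward.
    (* The tail has one constraint less. A trivial constraint at [n] keeps the length, so that
       [n = 0] is no special case. *)
    pose B' k := if (k < n)%N then B k.+1 else setT.
    have mB' k : measurable (B' k) by rewrite /B'; case: ifPn.
    rewrite (_ : _ @^-1` _ = B 0%N `*` (box n B')); last first.
      apply/seteqP; split=> [[f s] h|[f s] [/= f0 h] [|k]//= kn].
        split; first exact: (h 0%N).
        by move=> k kn; rewrite /B'; case: ifPn => // {}kn; exact: (h k.+1).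
      by have := h k (ltnW kn); rewrite /B' kn.
    rewrite /m1 /= product_measure1E//; last exact: measurable_box.
    have [_ law] := hF.
    rewrite [LHS](@iid_box 0)// [X in (X * _)%E](law 0%N)//.
    rewrite [X in (_ * X)%E](@iid_box 0 n B' mB').
    rewrite [in RHS]big_ord_recr/= [in X in (_ * (_ * X))%E]/B' ltnn.
    rewrite probability_setT mule1.
    rewrite big_ord_recl; congr (_ * _)%E.
    by apply: eq_bigr => k _; rewrite /B' ltn_ord.
have mC' : measurable [set t : seqspace T | C (t 0%N, fun k => t k.+1)].
  by have := mshift measurableT C mC; rewrite setTI.
have := m2E _ mC'; rewrite /m2 /m1 /= /distribution /pushforward /=.
rewrite (_ : _ @^-1` _ = C); last by apply/seteqP; split=> -[].
move=> ->; rewrite /product_measure1 ge0_integral_pushforward//.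
- apply: eq_integral => w _ /=; congr (P _).
  by apply/seteqP; split=> w' /=; rewrite xsectionE.
- exact: (measurable_fun_xsection (distribution P (sample 0)) mC).
Qed.

End iid_sequence.

(** * Discounted sums of real sequences *)

Section discounted_sums.
Context (R : realType).
Implicit Types (a b e : nat -> R) (n N : nat).

(** The expected total payment before time [N] if [b n] is paid at time [n] and, after each payment,
    the process is killed with probability [a n]. *)
Definition discounted_sum a b N :=
  \sum_(n < N) b n * \prod_(k < n) (1 - a k).

Lemma discounted_sumS a b N :
  discounted_sum a b N.+1 = b 0%N + (1 - a 0%N) *
    discounted_sum (fun k => a k.+1) (fun k => b k.+1) N.
Proof.
rewrite /discounted_sum big_ord_recl big_ord0 mulr1; congr +%R.
rewrite mulr_sumr; apply: eq_bigr => i _.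
by rewrite [in LHS]big_ord_recl mulrCA.
Qed.

(** Paying the killing rate itself gives the probability of having been killed, so the sum
    telescopes. *)
Lemma discounted_sum_rate a N :
  discounted_sum a a N = 1 - \prod_(k < N) (1 - a k).
Proof.
elim: N a => [|N IH] a; first by rewrite /discounted_sum !big_ord0 subrr.
rewrite discounted_sumS IH big_ord_recl /=; ring.
Qed.

Lemma discounted_sum_ge0 a b N : (forall n, a n <= 1) -> (forall n, 0 <= b n) ->
  0 <= discounted_sum a b N.
Proof.
move=> a1 b0; apply: sumr_ge0 => n _; apply: mulr_ge0 => //.
by apply: prodr_ge0 => k _; rewrite subr_ge0.
Qed.

Lemma le_discounted_sum a b b' N : (forall n, a n <= 1) ->
  (forall n, b n <= b' n) -> discounted_sum a b N <= discounted_sum a b' N.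
Proof.
move=> a1 bb; apply: ler_sum => n _; apply: ler_wpM2r => //.
by apply: prodr_ge0 => k _; rewrite subr_ge0.
Qed.

Lemma discounted_sum_le1 a b N : (forall n, 0 <= a n <= 1) ->
  (forall n, b n <= a n) -> discounted_sum a b N <= 1.
Proof.
move=> a01 ba; rewrite (@le_trans _ _ (discounted_sum a a N))//.
  by apply: le_discounted_sum => // n; case/andP: (a01 n).
rewrite discounted_sum_rate gerBl; apply: prodr_ge0 => k _.
by rewrite subr_ge0; case/andP: (a01 k).
Qed.

Lemma discounted_sum_lin a b b' x y N :
  discounted_sum a (fun n => x * b n + y * b' n) N =
  x * discounted_sum a b N + y * discounted_sum a b' N.
Proof.
rewrite /discounted_sum !mulr_sumr -big_split /=; apply: eq_bigr => n _.
by rewrite mulrDl !mulrA.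
Qed.

(** At the first step the difference splits into the discrepancy of [b], that of [a] multiplied by
    the later sum [V'], and the later difference discounted by [1 - a 0]. As [0 <= b' <= a'], the
    sum [V'] is between [0] and [1]; the two discrepancies give the factor [2]. Only the rate [a]
    discounts the error. *)
Lemma discounted_sum_compare a a' b b' e N :
  (forall n, 0 <= a n <= 1) -> (forall n, 0 <= a' n <= 1) ->
  (forall n, 0 <= b' n <= a' n) ->
  (forall n, `|a n - a' n| <= e n) -> (forall n, `|b n - b' n| <= e n) ->
  `|discounted_sum a b N - discounted_sum a' b' N| <= 2 * discounted_sum a e N.
Proof.
elim: N a a' b b' e => [|N IH] a a' b b' e a01 a'01 b'a' aa' bb'.
  by rewrite /discounted_sum !big_ord0 subrr normr0 mulr0.
rewrite !discounted_sumS.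
set V := discounted_sum _ _ N; set V' := discounted_sum _ _ N.
set W := discounted_sum _ _ N.
have VV' : `|V - V'| <= 2 * W by apply: IH.
have /andP[a0 a1] := a01 0%N.
have V'0 : 0 <= V'.
  apply: discounted_sum_ge0 => n; first by case/andP: (a'01 n.+1).
  by case/andP: (b'a' n.+1).
have V'1 : V' <= 1.
  by apply: discounted_sum_le1 => // n; case/andP: (b'a' n.+1).
have -> : b 0%N + (1 - a 0%N) * V - (b' 0%N + (1 - a' 0%N) * V') =
  (b 0%N - b' 0%N) + (1 - a 0%N) * (V - V') - (a 0%N - a' 0%N) * V' by ring.
have -> : 2 * (e 0%N + (1 - a 0%N) * W) =
  e 0%N + (1 - a 0%N) * (2 * W) + e 0%N by ring.
rewrite (le_trans (ler_normB _ _))// lerD//.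
  rewrite (le_trans (ler_normD _ _))// lerD// normrM ger0_norm ?subr_ge0//.
  by rewrite ler_wpM2l// subr_ge0.
by rewrite normrM (ger0_norm V'0) -[leRHS]mulr1 ler_pM.
Qed.

(** In independent trials with success probabilities [a 0, ..., a N.-1], the [n]-th term is the
    probability that the last success occurs at [N.-1 - n]. Reversing time gives a sum whose payment
    equals its killing rate. *)
Lemma discounted_sum_reverse a N : (forall n, 0 <= a n <= 1) ->
  \sum_(n < N) a (N.-1 - n)%N * \prod_(k < n) (1 - a (N - n + k)%N) <= 1.
Proof.
move=> a01; pose b i := a (N.-1 - i)%N.
rewrite (_ : \sum_(n < N) _ = discounted_sum b b N); last first.
  apply: eq_bigr => -[n /= nN] _; congr (_ * _).
  rewrite (reindex_inj rev_ord_inj); apply: eq_bigr => -[k /= kn] _.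
  by rewrite /b; congr (1 - a _); lia.
by apply: discounted_sum_le1 => n; rewrite /b.
Qed.

(** The partial products decrease, and each of the infinitely many indices with [a k >= delta]
    contributes a factor at most [1 - delta]. *)
Lemma prod_recurrent_cvg0 a (delta : R) : (forall n, 0 <= a n <= 1) -> 0 < delta ->
  (forall n, exists2 k, (n <= k)%N & delta <= a k) ->
  \prod_(k < n) (1 - a k) @[n --> \oo] --> 0.
Proof.
move=> a01 d0 ad.
have p0 n : 0 <= \prod_(k < n) (1 - a k).
  by apply: prodr_ge0 => k _; rewrite subr_ge0; case/andP: (a01 k).
have pd : {homo (fun n => \prod_(k < n) (1 - a k)) : m n / (m <= n)%N >-> n <= m}.
  apply: homo_leq => //; first by move=> y x z xy yz; exact: le_trans yz xy.
  move=> n; rewrite big_ord_recr /= -[leRHS]mulr1 ler_wpM2l ?p0// gerBl.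
  by case/andP: (a01 n).
have d1 : delta <= 1.
  by have [k _ dk] := ad 0%N; rewrite (le_trans dk)//; case/andP: (a01 k).
have small j : exists n, \prod_(k < n) (1 - a k) <= (1 - delta) ^+ j.
  elim: j => [|j [n nj]]; first by exists 0%N; rewrite big_ord0 expr0.
  have [k nk dk] := ad n; exists k.+1.
  rewrite big_ord_recr exprSr /= ler_pM ?p0 ?subr_ge0//.
  - by case/andP: (a01 k).
  - exact: le_trans (pd _ _ nk) nj.
  - by rewrite lerB.
apply/cvgrPdist_le => e e0.
have geo : (1 - delta) ^+ j @[j --> \oo] --> (0 : R).
  by apply: cvg_expr; rewrite ger0_norm ?subr_ge0// gtrBl.
have /cvgrPdist_le/(_ _ e0)[j _ /(_ j (leqnn j))/=] := geo.
rewrite sub0r normrN ger0_norm ?exprn_ge0 ?subr_ge0// => je.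
have [n nj] := small j.
exists n => // k /= nk; rewrite sub0r normrN ger0_norm ?p0//.
exact: le_trans (pd _ _ nk) (le_trans nj je).
Qed.

End discounted_sums.

(** * Shift-invariant measures *)

Section shift_invariant_measure.
Context (R : realType) (d : measure_display) (T : measurableType d)
  (m : {measure set (seqspace T) -> \bar R}).

Definition shiftn n (t : seqspace T) : seqspace T := fun k => t (n + k)%N.

Lemma measurable_shiftn n : measurable_fun setT (shiftn n).
Proof. by apply: measurable_to_seqspace => k; exact: measurable_coordinate. Qed.

Lemma measurable_at n (B : set T) : measurable B ->
  measurable [set t : seqspace T | B (t n)].
Proof. by move=> mB; have := measurable_coordinate n measurableT mB; rewrite setTI. Qed.

Lemma measurable_shiftn_preimage n (A : set (seqspace T)) : measurable A ->
  measurable (shiftn n @^-1` A).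
Proof. by move=> mA; have := measurable_shiftn n measurableT mA; rewrite setTI. Qed.

Hypothesis minv : forall A : set (seqspace T), measurable A ->
  m (shiftn 1 @^-1` A) = m A.

Lemma measure_shiftn n (A : set (seqspace T)) : measurable A ->
  m (shiftn n @^-1` A) = m A.
Proof.
move=> mA; elim: n => [//|n IHn].
rewrite -IHn -[RHS]minv; last exact: measurable_shiftn_preimage.
by congr (m (_ @^-1` _)); apply/funext => t; apply/funext => k; rewrite /shiftn addnA.
Qed.

Lemma integral_shiftn (n : nat) (G : seqspace T -> \bar R) :
  measurable_fun setT G -> (forall t, (0 <= G t)%E) ->
  (\int[m]_t G (shiftn n t) = \int[m]_t G t)%E.
Proof.
move=> mG G0; have := ge0_integral_pushforward (measurable_shiftn n) m measurableT mG.
move=> /(_ (fun t _ => G0 t)); rewrite preimage_setT => <-.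
apply: (@eq_measure_integral _ _ _ _ m
  (pushforward_measure m (measurable_shiftn n))).
by move=> A mA _; exact: measure_shiftn.
Qed.

Definition visits_io (B : set T) : set (seqspace T) :=
  lim_sup_set (fun k => [set t : seqspace T | B (t k)]).

Lemma measurable_visits_io (B : set T) : measurable B -> measurable (visits_io B).
Proof.
move=> mB; apply: bigcapT_measurable => n; apply: bigcup_measurable => k _.
exact: measurable_at.
Qed.

(* Shifting the [k]-th event by [n - k] places all the visits to [A] at time [n],
   where the preimages of [W] are still disjoint. *)
Lemma wandering_sum (W : set (seqspace T)) (A : set T) n :
  measurable W -> measurable A ->
  (forall i j, i != j -> shiftn i @^-1` W `&` shiftn j @^-1` W = set0) ->
  (\sum_(k < n) m (W `&` [set t | A (t k)]) <= m [set t | A (t 0%N)])%E.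
Proof.
move=> mW mA dW.
pose E (k : 'I_n) := shiftn (n - k) @^-1` W `&` [set t | A (t n)].
have mE k : measurable (E k).
  by apply: measurableI; [exact: measurable_shiftn_preimage|exact: measurable_at].
rewrite (eq_bigr (fun k => m (E k))); last first.
  move=> [k /= kn] _; rewrite -(measure_shiftn (n - k)); last first.
    by apply: measurableI => //; exact: measurable_at.
  congr (m _); rewrite /E preimage_setI /=; congr (_ `&` _).
  by rewrite /preimage /shiftn /= subnK// ltnW.
rewrite -measure_bigsetU_ord//; last first.
  apply/trivIsetP => i j _ _ ij; rewrite /E setIACA dW ?set0I//.
  apply: contra ij => /eqP ij; apply/eqP/val_inj => /=.
  by have := ltn_ord i; have := ltn_ord j; lia.
rewrite -(measure_shiftn n); last exact: measurable_at.
apply: le_measure; rewrite ?inE.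
- exact: bigsetU_measurable.
- by apply: measurable_shiftn_preimage; exact: measurable_at.
- apply: (big_ind (fun S : set _ => S `<=` _)) => // [S1 S2 S1P S2P|k _ t [_ /=]].
    by rewrite subUset.
  by rewrite /shiftn addn0.
Qed.

Variable A : nat -> set T.
Hypothesis mA : forall r, measurable (A r).
Hypothesis Afin : forall r, (m [set t | A r (t 0%N)] < +oo)%E.
Hypothesis Arec : m (~` \bigcup_r visits_io (A r)) = 0%E.

(** A form of Maharam's criterion. By [wandering_sum] and Borel-Cantelli almost no path in [W]
    visits a given [A r] infinitely often, whereas almost every path does so for some [r]. *)
Lemma wandering_null (W : set (seqspace T)) : measurable W ->
  (forall i j, i != j -> shiftn i @^-1` W `&` shiftn j @^-1` W = set0) ->
  m W = 0%E.
Proof.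
move=> mW dW.
pose F r k := W `&` [set t | A r (t k)].
have mF r k : measurable (F r k) by apply: measurableI => //; exact: measurable_at.
have F0 r : m (lim_sup_set (F r)) = 0%E.
  apply: lim_sup_set_cvg0 => //; apply: le_lt_trans (Afin r).
  apply: lime_le; first by apply: is_cvg_nneseries.
  by apply: nearW => n; rewrite big_mkord; exact: wandering_sum.
have mN : measurable (~` \bigcup_r visits_io (A r)).
  by apply: measurableC; apply: bigcupT_measurable => r; exact: measurable_visits_io.
apply/negligibleP => //.
apply: (@negligibleS _ _ _ _
  ((~` \bigcup_r visits_io (A r)) `|` \bigcup_r lim_sup_set (F r))).
  move=> t Wt.
  have [[r _ rt]|] := pselect ((\bigcup_r visits_io (A r)) t); last by left.
  right; exists r => // n _; have [k nk Ak] := rt n I; by exists k.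
apply: negligibleU; first exact/negligibleP.
apply: negligible_bigcup => r; apply/negligibleP; last exact: F0.
by apply: bigcapT_measurable => n; apply: bigcup_measurable => k _.
Qed.

(** Poincare recurrence in infinite measure. The paths in [B] at time [0] that never return form a
    wandering set [W]; a path with a last visit to [B] at time [k] lies in [W] after a shift by
    [k]. *)
Lemma conservative (B : set T) : measurable B ->
  m.-negligible ([set t | B (t 0%N)] `\` visits_io B).
Proof.
move=> mB.
pose W := [set t : seqspace T | B (t 0%N)] `\`
  \bigcup_k [set t : seqspace T | B (t k.+1)].
have mW : measurable W.
  apply: measurableD; first exact: measurable_at.
  by apply: bigcupT_measurable => k; exact: measurable_at.
have dW i j : (i < j)%N -> shiftn i @^-1` W `&` shiftn j @^-1` W = set0.
  move=> ij; rewrite -subset0 => t [[_ nB] [B0 _]]; apply: nB.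
  (* Time [j] is a visit to [B] after time [i]; the predecessor compensates for the [k.+1] in
     [W]. *)
  exists (j - i).-1 => //=; move: B0; rewrite /shiftn /= addn0.
  by rewrite prednK ?subn_gt0// subnKC// ltnW.
have W0 : m W = 0%E.
  apply: wandering_null => // i j; rewrite neq_lt => /orP[ij|ji]; first exact: dW.
  by rewrite setIC; exact: dW.
apply: (@negligibleS _ _ _ _ (\bigcup_n shiftn n @^-1` W)); last first.
  apply: negligible_bigcup => n; apply/negligibleP.
    exact: measurable_shiftn_preimage.
  by rewrite -[RHS]W0; exact: measure_shiftn.
move=> t [/= B0 /existsNP[n /not_implyP[_ nB]]].
have nBk k : (n <= k)%N -> ~ B (t k) by move=> nk Bk; apply: nB; exists k.
have ex : exists k, `[< B (t k) >] by exists 0%N; apply/asboolP.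
have bnd k : `[< B (t k) >] -> (k <= n)%N.
  by move=> /asboolP Bk; rewrite leqNgt; apply/negP => /ltnW/nBk.
case: (ex_maxnP ex bnd) => k /asboolP Bk kmax; exists k => //.
split; first by rewrite /= /shiftn addn0.
move=> [j _ /=]; rewrite /shiftn => /asboolP/kmax.
by rewrite addnS -ltn_subRL subnn ltn0.
Qed.

End shift_invariant_measure.

(** * Discounted sums along stationary paths *)

Section discounted_paths.
Context (R : realType) (d : measure_display) (T : measurableType d).
Implicit Types a b : T -> R.

(* Rewards and killing start at time [1]; time [0] is left for the weight of the
   starting point. *)
Definition discounted_path a b N (t : seqspace T) : R :=
  discounted_sum (fun k => a (t k.+1)) (fun k => b (t k.+1)) N.

Lemma measurable_fun_at a n : measurable_fun setT a ->
  measurable_fun setT (fun t : seqspace T => a (t n)).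
Proof. by move=> ma; exact: measurableT_comp (measurable_coordinate n). Qed.

Lemma measurable_discounted_path a b N :
  measurable_fun setT a -> measurable_fun setT b ->
  measurable_fun setT (discounted_path a b N).
Proof.
move=> ma mb; apply: measurable_sum => n; apply: measurable_funM.
  exact: measurable_fun_at.
apply: measurable_prod => k _; apply: measurable_funB => //.
exact: measurable_fun_at.
Qed.

End discounted_paths.

Section discounted_kernel.
Context (R : realType) (d : measure_display) (T : measurableType d)
  (m : {measure set (seqspace T) -> \bar R}).
Hypothesis minv : forall A : set (seqspace T), measurable A ->
  m (shiftn 1 @^-1` A) = m A.
Implicit Types psi phi g : T -> R.

Lemma integral_at n g : measurable_fun setT g -> (forall x, 0 <= g x) ->
  (\int[m]_t (g (t n))%:E = \int[m]_t (g (t 0%N))%:E)%E.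
Proof.
move=> mg g0.
rewrite -(integral_shiftn minv n (G := fun t => (g (t 0%N))%:E)).
- by apply: eq_integral => t _; rewrite /shiftn addn0.
- by apply/measurable_EFinP; exact: measurable_fun_at.
- by move=> t; rewrite lee_fin.
Qed.

(* Shifting the [n]-th term by [N - 1 - n] brings all the rewards to time [N];
   the weights then telescope to at most [1]. *)
Lemma discounted_kernel_le psi g N :
  measurable_fun setT psi -> (forall x, 0 <= psi x <= 1) ->
  measurable_fun setT g -> (forall x, 0 <= g x) ->
  (\int[m]_t (psi (t 0%N) * discounted_path psi g N t)%:E <=
   \int[m]_t (g (t 0%N))%:E)%E.
Proof.
move=> mpsi psi01 mg g0.
pose w n (t : seqspace T) :=
  psi (t 0%N) * (g (t n.+1) * \prod_(k < n) (1 - psi (t k.+1))).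
have mw n : measurable_fun setT (w n).
  apply: measurable_funM; first exact: measurable_fun_at.
  apply: measurable_funM; first exact: measurable_fun_at.
  apply: measurable_prod => k _; apply: measurable_funB => //; exact: measurable_fun_at.
have w0 n t : 0 <= w n t.
  apply: mulr_ge0; first by case/andP: (psi01 (t 0%N)).
  apply: mulr_ge0 => //; apply: prodr_ge0 => k _.
  by rewrite subr_ge0; case/andP: (psi01 (t k.+1)).
have -> : (\int[m]_t (psi (t 0%N) * discounted_path psi g N t)%:E =
    \sum_(n < N) \int[m]_t (w n (shiftn (N.-1 - n) t))%:E)%E.
  rewrite (eq_integral (fun t => \sum_(n < N) (w n t)%:E)%E); last first.
    by move=> t _; rewrite sumEFin mulr_sumr.
  rewrite ge0_integral_sum//; last 2 first.
  - by move=> n; apply/measurable_EFinP.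
  - by move=> n t _; rewrite lee_fin.
  apply: eq_bigr => n _.
  rewrite (integral_shiftn minv (N.-1 - n) (G := fun t => (w n t)%:E))//.
    exact/measurable_EFinP.
  by move=> t; rewrite lee_fin.
rewrite -ge0_integral_sum//; last 2 first.
- move=> n; apply/measurable_EFinP.
  by apply: measurableT_comp => //; exact: measurable_shiftn.
- by move=> n t _; rewrite lee_fin.
rewrite -(integral_at N mg g0); apply: ge0_le_integral => //.
- by move=> t _; apply: sume_ge0 => n _; rewrite lee_fin.
- apply: emeasurable_sum => n; apply/measurable_EFinP.
  by apply: measurableT_comp => //; exact: measurable_shiftn.
- by apply/measurable_EFinP; exact: measurable_fun_at.
- move=> t _; rewrite sumEFin lee_fin.
  rewrite (_ : \sum_(n < N) _ = g (t N) * \sum_(n < N) psi (t (N.-1 - n)%N) *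
      \prod_(k < n) (1 - psi (t (N - n + k)%N))); last first.
    rewrite mulr_sumr; apply: eq_bigr => -[n /= nN] _.
    rewrite /w /shiftn addn0 [in RHS]mulrCA; congr (_ * (g (t _) * _)); first by lia.
    by apply: eq_bigr => k _; congr (1 - psi (t _)); lia.
  rewrite -[leRHS]mulr1 ler_wpM2l//.
  by apply: (@discounted_sum_reverse _ (fun k => psi (t k))).
Qed.

(** This is [discounted_kernel_le] for the rate [lam * psi], the factor [lam] of the starting weight
    being moved to the reward. The resulting bound is free of [lam] and [N]. *)
Lemma discounted_kernel_scaled_le (lam : R) psi g N : 0 <= lam ->
  measurable_fun setT psi -> (forall x, 0 <= lam * psi x <= 1) ->
  measurable_fun setT g -> (forall x, 0 <= g x) ->
  (\int[m]_t (psi (t 0%N) * discounted_path (fun x => lam * psi x)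
      (fun x => lam * g x) N t)%:E <= \int[m]_t (g (t 0%N))%:E)%E.
Proof.
move=> lam0 mpsi lpsi01 mg g0.
have mlpsi : measurable_fun setT (fun x => lam * psi x) by exact: measurable_funM.
have := discounted_kernel_le N mlpsi lpsi01 mg g0; apply: le_trans.
rewrite le_eqVlt; apply/orP; left; apply/eqP; apply: eq_integral => t _; congr EFin.
rewrite -mulrA mulrCA; congr (_ * _).
rewrite /discounted_path /discounted_sum mulr_sumr; apply: eq_bigr => n _.
by rewrite mulrA.
Qed.

Variable A : nat -> set T.
Hypothesis mA : forall r, measurable (A r).
Hypothesis Afin : forall r, (m [set t | A r (t 0%N)] < +oo)%E.
Hypothesis Arec : m (~` \bigcup_r visits_io (A r)) = 0%E.

(** A starting point with [psi > 0] lies in some level set [psi >= 1/(j+1)], and each level set is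
    conservative. Positive values alone would not make the survival probability vanish. *)
Lemma recurrent_level psi : measurable_fun setT psi ->
  {ae m, forall t, 0 < psi (t 0%N) ->
    exists2 delta : R, 0 < delta &
      forall n, exists2 k, (n <= k)%N & delta <= psi (t k)}.
Proof.
move=> mpsi; pose B j := psi @^-1` `[j.+1%:R^-1, +oo[%classic.
have mB j : measurable (B j).
  by rewrite /B -[X in measurable X]setTI; exact: mpsi.
rewrite /prop_near1 /nbhs /= /almost_everywhere.
apply: (@negligibleS _ _ _ m (\bigcup_j ([set t | B j (t 0%N)] `\` visits_io (B j)))).
  move=> t /not_implyP[psi0 nrec].
  have [j _ /(_ j (leqnn j))/= jpsi] := near_infty_natSinv_lt (PosNum psi0).
  exists j => //; split => /=; first by rewrite /B /= in_itv/= andbT ltW.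
  move=> io; apply: nrec; exists j.+1%:R^-1 => // n.
  have [k nk Bk] := io n I; exists k => //.
  by move: Bk; rewrite /B /= in_itv/= andbT.
by apply: negligible_bigcup => j; exact: conservative minv A mA Afin Arec _ (mB j).
Qed.

(** For the reward [psi] the sum is the killing probability, which tends to [1] almost everywhere on
    [psi > 0]. For [phi] only an upper bound is at hand; the same bound for [psi - phi], subtracted
    from the case of [psi], supplies the lower one. *)
Lemma discounted_kernel_cvg (lam : R) psi phi :
  0 < lam -> lam <= 1 ->
  measurable_fun setT psi -> measurable_fun setT phi ->
  (forall x, 0 <= phi x <= psi x) -> (forall x, psi x <= 1) ->
  (\int[m]_t (psi (t 0%N))%:E < +oo)%E ->
  (\int[m]_t (psi (t 0%N) * discounted_path (fun x => lam * psi x)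
      (fun x => lam * phi x) N t)%:E @[N --> \oo] -->
    \int[m]_t (phi (t 0%N))%:E)%E.
Proof.
move=> lam0 lam1 mpsi mphi phipsi psi1 psifin.
have psi0 x : 0 <= psi x by case/andP: (phipsi x); exact: le_trans.
have lpsi01 x : 0 <= lam * psi x <= 1.
  by rewrite mulr_ge0 ?(ltW lam0)//= mulr_ile1// ltW.
have mlpsi : measurable_fun setT (fun x => lam * psi x) by exact: measurable_funM.
pose J g N t := psi (t 0%N) *
  discounted_path (fun x => lam * psi x) (fun x => lam * g x) N t.
have mJ g N : measurable_fun setT g ->
    measurable_fun setT (fun t : seqspace T => (J g N t)%:E).
  move=> mg; apply/measurable_EFinP; apply: measurable_funM.
    exact: measurable_fun_at.
  by apply: measurable_discounted_path => //; exact: measurable_funM.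
have J0 g N t : (forall x, 0 <= g x) -> 0 <= J g N t.
  move=> g0; apply: mulr_ge0 => //; apply: discounted_sum_ge0 => n.
    by case/andP: (lpsi01 (t n.+1)).
  by apply: mulr_ge0 => //; exact: ltW.
have Jle g N : measurable_fun setT g -> (forall x, 0 <= g x) ->
    (\int[m]_t (J g N t)%:E <= \int[m]_t (g (t 0%N))%:E)%E.
  by move=> mg g0; exact: discounted_kernel_scaled_le (ltW lam0) _ _ _ _.
have Jpsi : (\int[m]_t (J psi N t)%:E @[N --> \oo] --> \int[m]_t (psi (t 0%N))%:E)%E.
  have JE N t : J psi N t = psi (t 0%N) * (1 - \prod_(k < N) (1 - lam * psi (t k.+1))).
    by rewrite /J -(@discounted_sum_rate _ (fun k => lam * psi (t k.+1))).
  have [|||||_ _ //] := @dominated_convergence _ _ _ m setT measurableT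
      (fun N t => (J psi N t)%:E) (fun t => (psi (t 0%N))%:E)
      (fun t => (psi (t 0%N))%:E).
  - by move=> N; exact: mJ.
  - by apply/measurable_EFinP; exact: measurable_fun_at.
  - have [Z [mZ Z0 subZ]] := recurrent_level mpsi.
    exists Z; split => // t nt; apply: subZ => rec; apply: nt => _.
    apply: cvg_EFin; first exact: nearW.
    rewrite [X in X @ _](_ : _ = fun N =>
      psi (t 0%N) * (1 - \prod_(k < N) (1 - lam * psi (t k.+1)))); last first.
      by apply/funext => N /=; exact: JE.
    have [p0|] := ltP 0 (psi (t 0%N)); last first.
      move=> p0; have -> : psi (t 0%N) = 0 by apply/eqP; rewrite eq_le p0 psi0.
      rewrite [X in X @ _](_ : _ = fun=> 0); first exact: cvg_cst.
      by apply/funext => N; rewrite mul0r.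
    rewrite -[X in _ --> X]mulr1; apply: cvgM; first exact: cvg_cst.
    rewrite -[X in _ --> X]subr0; apply: cvgB; first exact: cvg_cst.
    have [delta d0 drec] := rec p0.
    apply: (@prod_recurrent_cvg0 _ (fun k => lam * psi (t k.+1)) (lam * delta)) => //.
      exact: mulr_gt0.
    (* Killing starts at time [1]: a visit from time [n.+1] on is requested, and its index is
       lowered by one. *)
    move=> n; have [[|k] nk dk] := drec n.+1 => //.
    by exists k => //; rewrite ler_pM2l.
  - apply/integrableP; split; first by apply/measurable_EFinP; exact: measurable_fun_at.
    by under eq_integral do rewrite gee0_abs ?lee_fin//.
  - apply: nearW => t N _; rewrite gee0_abs ?lee_fin ?J0//.
    rewrite JE -[leRHS]mulr1 ler_wpM2l// gerBl; apply: prodr_ge0 => k _.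
    by rewrite subr_ge0; case/andP: (lpsi01 (t k.+1)).
pose chi x := psi x - phi x.
have chi0 x : 0 <= chi x by rewrite subr_ge0; case/andP: (phipsi x).
have phi0 x : 0 <= phi x by case/andP: (phipsi x).
have mchi : measurable_fun setT chi by exact: measurable_funB.
have split_psi : (\int[m]_t (psi (t 0%N))%:E =
    \int[m]_t (phi (t 0%N))%:E + \int[m]_t (chi (t 0%N))%:E)%E.
  rewrite -ge0_integralD//; last 4 first.
  - by move=> t _; rewrite lee_fin.
  - by apply/measurable_EFinP; exact: measurable_fun_at.
  - by move=> t _; rewrite lee_fin.
  - by apply/measurable_EFinP; exact: measurable_fun_at.
  by apply: eq_integral => t _; rewrite -EFinD /chi addrC subrK.
have split_J N : (\int[m]_t (J psi N t)%:E =
    \int[m]_t (J phi N t)%:E + \int[m]_t (J chi N t)%:E)%E.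
  rewrite -ge0_integralD//; last 4 first.
  - by move=> t _; rewrite lee_fin J0.
  - exact: mJ.
  - by move=> t _; rewrite lee_fin J0.
  - exact: mJ.
  apply: eq_integral => t _; rewrite -EFinD /J -mulrDr; congr (_ * _)%:E.
  rewrite /discounted_path /discounted_sum -big_split /=; apply: eq_bigr => n _.
  by rewrite -mulrDl -mulrDr /chi addrC subrK.
have fin g : measurable_fun setT g -> (forall x, 0 <= g x <= psi x) ->
    (\int[m]_t (g (t 0%N))%:E)%E \is a fin_num.
  move=> mg gpsi; rewrite ge0_fin_numE; last first.
    by apply: integral_ge0 => t _; rewrite lee_fin; case/andP: (gpsi (t 0%N)).
  apply: le_lt_trans psifin; apply: ge0_le_integral => //.
  - by move=> t _; rewrite lee_fin; case/andP: (gpsi (t 0%N)).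
  - by apply/measurable_EFinP; exact: measurable_fun_at.
  - by apply/measurable_EFinP; exact: measurable_fun_at.
  - by move=> t _; rewrite lee_fin; case/andP: (gpsi (t 0%N)).
have finchi : (\int[m]_t (chi (t 0%N))%:E)%E \is a fin_num.
  by apply: fin => // x; rewrite chi0 /chi gerBl phi0.
apply: (@squeeze_cvge _ _ _ _
    (fun N => \int[m]_t (J psi N t)%:E - \int[m]_t (chi (t 0%N))%:E)%E
    (fun N => \int[m]_t (J phi N t)%:E)%E
    (fun=> \int[m]_t (phi (t 0%N))%:E)%E).
- apply: nearW => N; rewrite Jle// andbT split_J leeBlDr//.
  by rewrite leeD2l// Jle.
- rewrite [X in _ --> X](_ : _ =
    \int[m]_t (psi (t 0%N))%:E - \int[m]_t (chi (t 0%N))%:E)%E.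
    by apply: cvgeB => //; [rewrite fin_num_adde_defl// fin_numN|exact: cvg_cst].
  by rewrite split_psi addeK.
- exact: cvg_cst.
Qed.

End discounted_kernel.

(** * The law of a trajectory *)

Section sds_law.
Context (R : realType) (X : pmetricType R) (mu : probability (borel (cmap X)) R)
  (d : measure_display) (Omega : measurableType d) (P : probability Omega R)
  (F : nat -> {RV P >-> borel (cmap X)}).
Hypothesis hX : proper_metric X.
Hypothesis hF : iid_with_law mu F.
Implicit Types (A : set (seqspace (borel X))) (x y : X).

Lemma sds_cmap_orbit x n w : sds F x n w = cmap_orbit (sample F 0 w) x n.
Proof. by elim: n => //= n ->. Qed.

Lemma sdsS x n w :
  sds F x n.+1 w = cmap_orbit (sample F 1 w) (cmap_eval (F 0%N w) x) n.
Proof. by rewrite sds_cmap_orbit cmap_orbitS. Qed.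

Lemma measurable_trajectory : measurable_fun setT
  (fun z : borel X * Omega => trajectory F z.1 z.2 : seqspace (borel X)).
Proof.
have : measurable_fun setT (fun z : borel X * Omega =>
    (z.1, sample F 0 z.2) : borel X * seqspace (borel (cmap X))).
  apply: measurable_fun_pair; first exact: measurable_fst.
  by apply: measurableT_comp => //; exact: measurable_snd.
move=> /(measurableT_comp (measurable_path hX)); congr measurable_fun.
by apply/funext => z; apply/funext => n /=; rewrite /trajectory sds_cmap_orbit.
Qed.

Lemma measurable_sds n : measurable_fun setT
  (fun z : borel X * Omega => sds F z.1 n z.2 : borel X).
Proof.
exact: measurableT_comp (@measurable_coordinate _ (borel X) n) measurable_trajectory.
Qed.

Lemma measurable_sds_at x n : measurable_fun setT (sds F x n : Omega -> borel X).
Proof. exact: (measurable_fun_pair2 (x : borel X) (measurable_sds n)). Qed.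

Lemma measurable_trajectory_at x :
  measurable_fun setT (trajectory F x : Omega -> seqspace (borel X)).
Proof. exact: (measurable_fun_pair2 (x : borel X) measurable_trajectory). Qed.

Lemma Pr_from_xsection A x : Pr_from P F x A =
  P (xsection ((fun z : borel X * Omega => trajectory F z.1 z.2) @^-1` A) x).
Proof.
by rewrite /Pr_from /pushforward; congr (P _); apply/seteqP; split => w /=;
  rewrite xsectionE.
Qed.

Lemma measurable_trajectory_preimage A : measurable A ->
  measurable ((fun z : borel X * Omega => trajectory F z.1 z.2) @^-1` A).
Proof. by move=> mA; have := measurable_trajectory measurableT mA; rewrite setTI. Qed.

Lemma measurable_Pr_from A : measurable A ->
  measurable_fun setT (fun x : borel X => Pr_from P F x A).
Proof.
move=> mA; under eq_fun do rewrite Pr_from_xsection.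
exact: measurable_fun_xsection (measurable_trajectory_preimage mA).
Qed.

Lemma Pr_from_le1 A x : measurable A -> (Pr_from P F x A <= 1)%E.
Proof.
move=> mA; rewrite Pr_from_xsection; apply: probability_le1.
by apply: measurable_xsection; exact: measurable_trajectory_preimage.
Qed.

Lemma Pr_from_ge0 A x : (0 <= Pr_from P F x A)%E.
Proof. by rewrite /Pr_from /pushforward. Qed.

(** The Markov property, obtained by splitting off the first map. The constraint on the initial
    point is kept so that boxes can be peeled coordinate by coordinate. *)
Lemma Pr_from_markov (B : set (borel X)) A x : measurable A ->
  Pr_from P F x ([set t | B (t 0%N)] `&` (shiftn 1 @^-1` A)) =
  ((\1_B x)%:E * \int[P]_w Pr_from P F (sds F x 1 w) A)%E.
Proof.
move=> mA; pose C : set (borel (cmap X) * seqspace (borel (cmap X))) :=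
  [set p | A ((fun n => cmap_orbit p.2 (cmap_eval p.1 x) n) : seqspace (borel X))].
have mC : measurable C.
  have : measurable_fun setT (fun p : borel (cmap X) * seqspace (borel (cmap X)) =>
      (cmap_eval p.1 x, p.2) : borel X * seqspace (borel (cmap X))).
    apply: measurable_fun_pair => //.
    exact: measurableT_comp (measurable_cmap_eval_at x) measurable_fst.
  move=> /(measurableT_comp (measurable_path hX)) /(_ measurableT A mA).
  by rewrite setTI.
have shiftE w : shiftn 1 (trajectory F x w : seqspace (borel X)) =
    (fun n => cmap_orbit (sample F 1 w) (cmap_eval (F 0%N w) x) n).
  by apply/funext => n; rewrite /shiftn /trajectory add1n sdsS.
rewrite indicE; have [xB|xB] := boolP (x \in B); last first.
  rewrite mul0e /Pr_from /pushforward (_ : _ @^-1` _ = set0) ?measure0//.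
  by rewrite -subset0 => w [/= Bx _]; move: xB; rewrite notin_setE; exact.
rewrite mul1e -[RHS](_ : P [set w | C (F 0%N w, sample F 1 w)] = _).
  rewrite /Pr_from /pushforward; congr (P _); apply/seteqP; split=> w /=.
    by rewrite shiftE => -[].
  by rewrite shiftE => ?; split => //; exact: set_mem.
rewrite (split_sample_law hF mC); apply: eq_integral => w _.
rewrite /Pr_from /pushforward; congr (P _); apply/seteqP; split => w' /=;
  rewrite /C /= /preimage /=; congr A; apply/funext => n;
  by rewrite /trajectory sds_cmap_orbit.
Qed.

Lemma Pr_from_shift A x : measurable A ->
  Pr_from P F x (shiftn 1 @^-1` A) = (\int[P]_w Pr_from P F (sds F x 1 w) A)%E.
Proof.
move=> mA; have := Pr_from_markov setT x mA.
by rewrite indicT mul1e => <-; congr Pr_from; rewrite setTI.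
Qed.

End sds_law.

(** * The stationary law of trajectories *)

Section stationary_law.
Context (R : realType) (X : pmetricType R) (mu : probability (borel (cmap X)) R)
  (d : measure_display) (Omega : measurableType d) (P : probability Omega R)
  (F : nat -> {RV P >-> borel (cmap X)}).
Hypothesis hX : proper_metric X.
Hypothesis hF : iid_with_law mu F.
Variable nu : {sigma_finite_measure set (borel X) -> \bar R}.

(** The law of the trajectory started from [nu] on the whole space. As an image of [nu \x P] it is a
    measure by construction, and its integrals unfold by Tonelli. *)
Definition path_law : {measure set (seqspace (borel X)) -> \bar R} :=
  pushforward_measure
    (nu \x P)%E (measurable_trajectory F hX).

Lemma path_lawE A : measurable A ->
  path_law A = (\int[nu]_x Pr_from P F x A)%E.
Proof.
move=> mA; rewrite /path_law /= /pushforward /= /product_measure1 /=.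
by apply: eq_integral => x _; rewrite Pr_from_xsection.
Qed.

Lemma integral_path_law (G : seqspace (borel X) -> \bar R) :
  measurable_fun setT G -> (forall t, (0 <= G t)%E) ->
  (\int[path_law]_t G t = \int[nu \x P]_z G (trajectory F z.1 z.2))%E.
Proof.
move=> mG G0.
have := ge0_integral_pushforward (measurable_trajectory F hX)
  (nu \x P)%E measurableT mG (fun t _ => G0 t).
by rewrite preimage_setT.
Qed.

Lemma path_law_at (g : borel X -> \bar R) : measurable_fun setT g ->
  (forall x, (0 <= g x)%E) -> (\int[path_law]_t g (t 0%N) = \int[nu]_x g x)%E.
Proof.
move=> mg g0; rewrite integral_path_law//.
- rewrite /trajectory /= (fubini_tonelli1 (fun z => g z.1))//.
    apply: eq_integral => x _; rewrite /fubini_F /=.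
    by rewrite (integral_cst P measurableT (g x))
      [X in (_ * X)%E](@probability_setT _ _ _ P) mule1.
  by apply: measurableT_comp => //; exact: measurable_fst.
- by apply: measurableT_comp => //; exact: (@measurable_coordinate _ (borel X)).
Qed.

Hypothesis inv : forall U : set (borel X), measurable U ->
  nu U = (\int[nu]_x transition P F x U)%E.

(** Invariance says that [nu] is the image of [nu \x P] under one step, so the formula for functions
    is a change of variables followed by Tonelli. *)
Lemma invariant_integral (g : borel X -> \bar R) : measurable_fun setT g ->
  (forall x, (0 <= g x)%E) ->
  (\int[nu]_x g x = \int[nu]_x \int[P]_w g (sds F x 1 w))%E.
Proof.
move=> mg g0; pose step (z : borel X * Omega) : borel X := sds F z.1 1 z.2.
have ms : measurable_fun setT step by exact: measurable_sds.
transitivity (\int[pushforward (nu \x P)%E step]_x g x)%E.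
  apply: (@eq_measure_integral _ _ _ _
    (pushforward_measure (nu \x P)%E ms)).
  move=> U mU _; rewrite [LHS]inv//= /pushforward /= /product_measure1 /=.
  apply: eq_integral => x _; rewrite /transition; congr (P _).
  by apply/seteqP; split => w /=; rewrite xsectionE.
rewrite ge0_integral_pushforward// preimage_setT.
rewrite (fubini_tonelli1 (g \o step))//; first exact: measurableT_comp mg ms.
by move=> z /=.
Qed.

Lemma path_law_shift A : measurable A -> path_law (shiftn 1 @^-1` A) = path_law A.
Proof.
move=> mA; rewrite !path_lawE//; last exact: measurable_shiftn_preimage.
rewrite [RHS]invariant_integral//; last 2 first.
- exact: (measurable_Pr_from F hX mA).
- by move=> x; exact: Pr_from_ge0.
by apply: eq_integral => x _; exact: (Pr_from_shift hX hF).
Qed.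

End stationary_law.

(** * Exhaustion by balls and continuous functions *)

Section continuous_functions.
Context (R : realType) (X : pmetricType R).

Definition cball r : set X := [set x | mdist point x <= r].

Lemma measurable_cball r : measurable (cball r : set (borel X)).
Proof. by apply: measurable_closed; exact: closed_mball. Qed.

Lemma bigcup_cball : \bigcup_(n : nat) cball n%:R = setT.
Proof.
rewrite -subTset => x _; exists (Num.truncn (mdist point x)).+1 => //.
by rewrite /cball /= ltW// truncnS_gt.
Qed.

Lemma cball_measure_neq0 (nu : {measure set (borel X) -> \bar R}) :
  nu setT != 0%E -> exists n : nat, nu (cball n%:R) != 0%E.
Proof.
move=> nuT; apply: contrapT => /forallNP nu0; move/eqP: nuT; apply.
apply/(negligibleP _ measurableT); rewrite -[setT]bigcup_cball.
apply: negligible_bigcup => n; apply/negligibleP; first exact: measurable_cball.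
by apply: contrapT => /eqP; exact: nu0.
Qed.

Lemma continuous_borel_measurable (f : X -> R) :
  continuous f -> measurable_fun setT (f : borel X -> R).
Proof.
move=> /continuousP cf.
apply: (@measurability _ _ (borel X) R _ _ _ (RGenOpens.measurableE R)).
move=> _ [_ [a [b ->] <-]]; rewrite setTI; apply: measurable_open.
exact/cf/interval_open.
Qed.

(** Only [u] is confined to [K]; the other trajectory may lie outside, so uniform continuity on [K]
    alone would not suffice. *)
Lemma compact_unif_continuous (f : X -> R) (K : set X) (e : R) :
  continuous f -> compact K -> 0 < e ->
  exists2 delta : R, 0 < delta &
    forall u v, K u -> mdist u v < delta -> `|f u - f v| <= e.
Proof.
move=> cf /compact_near_coveringP cK e0.
have e20 : 0 < e / 2 by rewrite divr_gt0.
have near_ball u : exists2 delta : R, 0 < delta &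
    forall v, mdist u v < delta -> `|f u - f v| < e / 2.
  have /cvgrPdist_lt/(_ _ e20) := cf u.
  by move=> /nbhs_ballP[delta /= d0]; rewrite ballEmdist => h; exists delta.
have near0 : \forall delta \near (0 : R)^'+,
    K `<=` (fun u => forall v, mdist u v < delta -> `|f u - f v| <= e).
  apply: cK => u Ku; have [delta d0 h] := near_ball u.
  have d20 : 0 < delta / 2 by rewrite divr_gt0.
  exists ([set v | mdist u v < delta / 2], [set r | r < delta / 2]) => /=.
    split; last exact: nbhs_right_lt.
    by apply/nbhs_ballP; exists (delta / 2) => //; rewrite ballEmdist.
  move=> [u' r] /= [uu' rd] v u'v.
  have -> : f u' - f v = - (f u - f u') + (f u - f v) by ring.
  rewrite (le_trans (ler_normD _ _))// normrN [e]splitr lerD// ltW//; apply: h.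
    by rewrite (lt_le_trans uu')// ler_pdivrMr// ler_peMr// ?ler1n// ltW.
  rewrite (le_lt_trans (metric_triangle _ u' _))// [delta]splitr ltrD//.
  exact: lt_trans rd.
have [r [r0 hr]] := filter_ex (filterI (nbhs_right_gt (0 : R)) near0).
by exists r => // u v Ku; exact: hr.
Qed.

End continuous_functions.

Section recurrent_sds.
Context (R : realType) (X : pmetricType R) (mu : probability (borel (cmap X)) R)
  (d : measure_display) (Omega : measurableType d) (P : probability Omega R)
  (F : nat -> {RV P >-> borel (cmap X)}).
Hypothesis hX : proper_metric X.
Hypothesis hF : iid_with_law mu F.
Hypothesis hrec : recurrent P F.
Variable nu : {sigma_finite_measure set (borel X) -> \bar R}.
Hypothesis inv : forall U : set (borel X), measurable U ->
  nu U = (\int[nu]_x transition P F x U)%E.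
Hypothesis nu_fin : forall K : set X, compact K -> (nu K < +oo)%E.

Local Notation m := (path_law F hX nu).

Lemma path_law_initial (B : set (borel X)) : measurable B ->
  m [set t | B (t 0%N)] = nu B.
Proof.
move=> mB; rewrite path_lawE; last exact: (@measurable_at _ (borel X)).
rewrite -[in RHS](setIT B) -integral_indic//; apply: eq_integral => x _.
rewrite /Pr_from /pushforward indicE.
have [xB|xB] := boolP (x \in B).
  rewrite (_ : _ @^-1` _ = setT) ?probability_setT//.
  by rewrite -subTset => w _ /=; exact: set_mem.
rewrite (_ : _ @^-1` _ = set0) ?measure0//.
by rewrite -subset0 => w /= Bx; move: xB; rewrite notin_setE; exact.
Qed.

Lemma path_law_cball_fin (r : nat) :
  (m [set t | cball r%:R (t 0%N)] < +oo)%E.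
Proof.
rewrite (path_law_initial (measurable_cball _)); apply: nu_fin; exact: hX.
Qed.

(** No integer ball is visited infinitely often exactly when the distance to [x] tends to infinity.
    Equality of the two events, rather than an inclusion, transfers the value of [P] without a
    separate measurability argument. *)
Lemma path_law_recurrent :
  m (~` \bigcup_r visits_io (cball r%:R : set (borel X))) = 0%E.
Proof.
rewrite path_lawE; last first.
  apply: measurableC; apply: bigcupT_measurable => r.
  by apply: measurable_visits_io; exact: measurable_cball.
apply: integral0_eq => x _; rewrite -(hrec x) /Pr_from /pushforward.
congr (P _); apply/seteqP; split=> w /=.
  move=> nvis; apply/cvgryPge => M.
  have [r Mr] : exists r : nat, M + mdist point x <= r%:R.
    by exists (Num.truncn (M + mdist point x)).+1; rewrite ltW// truncnS_gt.
  have : ~ visits_io (cball r%:R : set (borel X)) (trajectory F x w).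
    by move=> v; apply: nvis; exists r.
  move=> /existsNP[n /not_implyP[_ nv]]; exists n => // k /= nk.
  have : ~ cball r%:R (sds F x k w) by move=> c; apply: nv; exists k.
  move=> /negP; rewrite -ltNge => far.
  have := metric_triangle point x (sds F x k w); rewrite (metric_sym x) => tri.
  by rewrite -(lerD2l (mdist point x)) addrC (le_trans Mr)// (le_trans (ltW far)).
move=> /cvgryPge far [r _ vis].
have [n _ nfar] := far (r%:R + mdist point x + 1).
have [k nk near] := vis n I.
have := nfar k nk => /=; apply/negP; rewrite -ltNge.
have := metric_triangle (sds F x k w) point x; rewrite (metric_sym _ point) => tri.
rewrite (le_lt_trans tri)// (@le_lt_trans _ _ (r%:R + mdist point x))// ?lerD2r//.
by rewrite ltrDl.
Qed.

End recurrent_sds.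

(** * Comparing two trajectories *)

Section coupling.
Context (R : realType) (X : pmetricType R) (mu : probability (borel (cmap X)) R)
  (d : measure_display) (Omega : measurableType d) (P : probability Omega R)
  (F : nat -> {RV P >-> borel (cmap X)}).
Hypothesis hX : proper_metric X.
Hypothesis hF : iid_with_law mu F.
Hypothesis hlc : locally_contractive P F.
Variables (psi phi : X -> R) (r : R) (y : X).
Hypotheses (cpsi : continuous psi) (cphi : continuous phi).
Hypothesis phipsi : forall x, 0 <= phi x <= psi x.
Hypothesis psi1 : forall x, psi x <= 1.
Hypothesis psi_supp : forall x, ~ cball r x -> psi x = 0.

Let phi0 x : 0 <= phi x. Proof. by case/andP: (phipsi x). Qed.
Let phi_le x : phi x <= psi x. Proof. by case/andP: (phipsi x). Qed.
Let psi0 x : 0 <= psi x. Proof. exact: le_trans (phi0 x) (phi_le x). Qed.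
Let mpsi : measurable_fun setT (psi : borel X -> R).
Proof. exact: continuous_borel_measurable. Qed.
Let mphi : measurable_fun setT (phi : borel X -> R).
Proof. exact: continuous_borel_measurable. Qed.

(** The sum of both discrepancies, so that one bound serves rates and rewards in
    [discounted_sum_compare]. *)
Definition gap n (z : borel X * Omega) : R :=
  `|psi (sds F z.1 n z.2) - psi (sds F y n z.2)| +
  `|phi (sds F z.1 n z.2) - phi (sds F y n z.2)|.

(** Outside the larger ball the threshold is [0]: off this event, every discrepancy from time [N] on
    occurs during a visit to that ball. *)
Definition late_gap (e : R) N : set (borel X * Omega) :=
  \bigcup_(n in [set n | (N <= n)%N])
    [set z | e * \1_(cball (r + 1)) (sds F z.1 n z.2) < gap n z].

Lemma gap_le2 n z : gap n z <= 2.
Proof.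
have bnd (a b : R) : 0 <= a <= 1 -> 0 <= b <= 1 -> `|a - b| <= 1.
  by move=> a01 b01; rewrite ler_norml; lra.
have b1 x : 0 <= psi x <= 1 by rewrite psi0 psi1.
have b2 x : 0 <= phi x <= 1 by rewrite phi0 (le_trans (phi_le x)).
by rewrite (_ : 2 = 1 + 1)// lerD// bnd.
Qed.

Lemma measurable_sds_snd n :
  measurable_fun setT (fun z : borel X * Omega => sds F y n z.2 : borel X).
Proof. exact: measurableT_comp (measurable_sds_at F hX y n) measurable_snd. Qed.

Lemma measurable_gap n : measurable_fun setT (gap n).
Proof.
have mg (f : borel X -> R) : measurable_fun setT f -> measurable_fun setT
    (fun z : borel X * Omega => `|f (sds F z.1 n z.2) - f (sds F y n z.2)|).
  move=> mf; apply: measurableT_comp => //; apply: measurable_funB.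
    exact: measurableT_comp mf (measurable_sds F hX n).
  exact: measurableT_comp mf (measurable_sds_snd n).
by apply: measurable_funD; exact: mg.
Qed.

Lemma measurable_late_gap e N : measurable (late_gap e N).
Proof.
apply: bigcup_measurable => n _.
rewrite -[X in measurable X]setTI; apply: measurable_fun_ltr => //.
  apply: measurable_funM => //.
  have mi : measurable_fun setT (\1_(cball (r + 1)) : borel X -> R).
    by apply: measurable_indic; exact: measurable_cball.
  exact: measurableT_comp mi (measurable_sds F hX n).
exact: measurable_gap.
Qed.

(* If [X_n^x] is outside the larger ball while [X_n^y] is inside the support,
   contraction along the visits of [X_n^y] to the support is violated; hence
   both starting points are needed. *)
Lemma late_gap_null e x : 0 < e ->
  P (xsection (\bigcap_N late_gap e N) x) = 0%E.
Proof.
move=> e0; have e20 : 0 < e / 2 by rewrite divr_gt0.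
have mx : measurable (xsection (\bigcap_N late_gap e N) x).
  apply: measurable_xsection; apply: bigcapT_measurable => N.
  exact: measurable_late_gap.
apply/negligibleP => //.
have [Nx [mNx Nx0 subx]] := hlc x (hX (x := point) (r := r + 1)).
have [Ny [mNy Ny0 suby]] := hlc y (hX (x := point) (r := r)).
apply: (@negligibleS _ _ _ _ (Nx `|` Ny)); last first.
  by apply: negligibleU; apply/negligibleP.
move=> w; rewrite /= xsectionE /= => late; apply: contrapT => /not_orP[nNx nNy].
have {subx}nNx : forall z, mdist (sds F x n w) (sds F z n w) *
    \1_(cball (r + 1)) (sds F x n w) @[n --> \oo] --> (0 : R).
  by apply: contrapT => h; apply: nNx; apply: subx.
have {suby}nNy : forall z, mdist (sds F y n w) (sds F z n w) *
    \1_(cball r) (sds F y n w) @[n --> \oo] --> (0 : R).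
  by apply: contrapT => h; apply: nNy; apply: suby.
have [d1 d10 hd1] := compact_unif_continuous cpsi (hX (x := point) (r := r + 1)) e20.
have [d2 d20 hd2] := compact_unif_continuous cphi (hX (x := point) (r := r + 1)) e20.
have d0 : 0 < Num.min d1 d2 by rewrite lt_min d10.
have /cvgrPdist_lt/(_ _ d0)[N1 _ hN1] := nNx y.
(* Closeness [1] is the margin between the radii [r] and [r + 1]. *)
have /cvgrPdist_lt/(_ _ ltr01)[N2 _ hN2] := nNy x.
have [n /= nN] := late (maxn N1 N2) I; apply/negP; rewrite -leNgt.
move: (hN1 n) (hN2 n) => /=; rewrite (leq_trans (leq_maxl _ _) nN).
rewrite (leq_trans (leq_maxr _ _) nN) !sub0r !normrN => /(_ isT) + /(_ isT).
rewrite /gap /= !indicE.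
set u := sds F x n w; set v := sds F y n w => near_x near_y.
have [uK|uK] := boolP (u \in cball (r + 1)).
  move: near_x; rewrite uK mulr1 ger0_norm ?mdist_ge0// lt_min => /andP[uv1 uv2].
  rewrite mulr1 [e]splitr lerD//.
    by apply: hd1 => //; exact: set_mem.
  by apply: hd2 => //; exact: set_mem.
have nu : ~ cball r u.
  move=> ur; move: uK; rewrite notin_setE; apply.
  by rewrite /cball /= (le_trans ur)// lerDl.
have nv : ~ cball r v.
  move=> vr; move: near_y; rewrite (mem_set vr) mulr1 ger0_norm ?mdist_ge0// => vu.
  move: uK; rewrite notin_setE; apply.
  by rewrite /cball /= (le_trans (metric_triangle _ v _))// lerD// ltW.
have phi_supp z : ~ cball r z -> phi z = 0.
  by move=> /psi_supp pz; apply/eqP; rewrite eq_le phi0 -pz phi_le.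
by rewrite !psi_supp// !phi_supp// subrr normr0 addr0 mulr0.
Qed.

End coupling.

Section coupling_error.
Context (R : realType) (X : pmetricType R) (mu : probability (borel (cmap X)) R)
  (d : measure_display) (Omega : measurableType d) (P : probability Omega R)
  (F : nat -> {RV P >-> borel (cmap X)}).
Hypothesis hX : proper_metric X.
Hypothesis hF : iid_with_law mu F.
Hypothesis hlc : locally_contractive P F.
Variable nu : {sigma_finite_measure set (borel X) -> \bar R}.
Hypothesis inv : forall U : set (borel X), measurable U ->
  nu U = (\int[nu]_x transition P F x U)%E.
Hypothesis nu_fin : forall K : set X, compact K -> (nu K < +oo)%E.
Variables (psi phi : X -> R) (r : R) (y : X).
Hypotheses (cpsi : continuous psi) (cphi : continuous phi).
Hypothesis phipsi : forall x, 0 <= phi x <= psi x.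
Hypothesis psi1 : forall x, psi x <= 1.
Hypothesis psi_supp : forall x, ~ cball r x -> psi x = 0.

Let phi0 x : 0 <= phi x. Proof. by case/andP: (phipsi x). Qed.
Let phi_le x : phi x <= psi x. Proof. by case/andP: (phipsi x). Qed.
Let psi0 x : 0 <= psi x. Proof. exact: le_trans (phi0 x) (phi_le x). Qed.
Let mpsi : measurable_fun setT (psi : borel X -> R).
Proof. exact: continuous_borel_measurable. Qed.
Let mphi : measurable_fun setT (phi : borel X -> R).
Proof. exact: continuous_borel_measurable. Qed.

Local Notation gap := (@gap R X d Omega P F psi phi y).
Local Notation late_gap := (@late_gap R X d Omega P F psi phi r y).
Let start : set (borel X * Omega) := cball r `*` setT.

Let mstart : measurable start.
Proof. by apply: measurableX => //; exact: measurable_cball. Qed.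

Let start_measure : (nu \x P)%E start = nu (cball r).
Proof.
rewrite product_measure1E//; last exact: measurable_cball.
by rewrite [X in (_ * X)%E](@probability_setT _ _ _ P) mule1.
Qed.

(** Continuity from above along decreasing events with null intersection; starting inside a ball
    makes their measures finite. *)
Lemma late_gap_small e : 0 < e ->
  ((nu \x P)%E (late_gap e N `&` start) @[N --> \oo] --> 0)%E.
Proof.
move=> e0; have mlate N : measurable (late_gap e N) by exact: measurable_late_gap.
have <- : (nu \x P)%E (\bigcap_N (late_gap e N `&` start)) = 0%E.
  apply/eqP; rewrite -measure_le0.
  have -> : 0%E = (nu \x P)%E (\bigcap_N late_gap e N).
    rewrite /product_measure1 /=; apply/esym/integral0_eq => x _.
    exact: (late_gap_null hX hlc y cpsi cphi phipsi psi_supp).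
  apply: le_measure; rewrite ?inE.
  - by apply: bigcapT_measurable => N; exact: measurableI.
  - exact: bigcapT_measurable.
  - by move=> z h N _; have [] := h N I.
apply: nonincreasing_cvg_mu.
- rewrite (@le_lt_trans _ _ ((nu \x P)%E start))//.
    by apply: le_measure; rewrite ?inE//; exact: measurableI.
  by rewrite start_measure; apply: nu_fin; exact: hX.
- by move=> N; exact: measurableI.
- by apply: bigcapT_measurable => N; exact: measurableI.
- move=> N N' NN'; apply/subsetPset; apply: setSI => z [n /= N'n zn].
  by exists n => //=; exact: leq_trans N'n.
Qed.

Definition discounted_reward (lam : R) N (t : seqspace (borel X)) : R :=
  discounted_path (fun x : borel X => lam * psi x) (fun x : borel X => lam * phi x) N t.

Local Notation J := discounted_reward.

Lemma measurable_discounted_reward lam N : measurable_fun setT (J lam N).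
Proof. by apply: measurable_discounted_path; exact: measurable_funM. Qed.

Lemma discounted_reward01 lam N t : 0 <= lam <= 1 -> 0 <= J lam N t <= 1.
Proof.
move=> /andP[lam0 lam1].
have lpsi01 x : 0 <= lam * psi x <= 1 by rewrite mulr_ge0//= mulr_ile1.
apply/andP; split.
  apply: discounted_sum_ge0 => n; last exact: mulr_ge0.
  by case/andP: (lpsi01 (t n.+1)).
by apply: discounted_sum_le1 => n //; exact: ler_wpM2l.
Qed.

Let chi : borel X -> R := \1_(cball (r + 1)).

(** On the bad event the difference is at most [1]. Off it, the comparison of discounted sums
    carries a factor [2]; each of the [N0] early steps has gap at most [2] and weight [lam], whence
    [4 * lam * N0], and the later ones contribute at most [e] on visits to the larger ball. *)
Lemma discounted_reward_coupling (lam e : R) N0 N z : 0 <= lam <= 1 -> 0 <= e ->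
  `|J lam N (trajectory F z.1 z.2) - J lam N (trajectory F y z.2)| <=
  \1_(late_gap e N0) z + 4 * lam * N0%:R +
  2 * discounted_path (fun x : borel X => lam * psi x)
        (fun x : borel X => lam * (e * chi x)) N (trajectory F z.1 z.2).
Proof.
move=> /andP[lam0 lam1] e0.
have lpsi01 x : 0 <= lam * psi x <= 1 by rewrite mulr_ge0//= mulr_ile1.
have lpsi1 x : lam * psi x <= 1 by case/andP: (lpsi01 x).
set t := trajectory F z.1 z.2; set t' := trajectory F y z.2.
set D := discounted_path _ _ _ _.
have D0 : 0 <= D.
  by apply: discounted_sum_ge0 => n //; rewrite !mulr_ge0// /chi indicE.
rewrite indicE; have [zlate|zgood] := boolP (z \in late_gap e N0).
  have bnd (a b : R) : 0 <= a <= 1 -> 0 <= b <= 1 -> `|a - b| <= 1.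
    by move=> a01 b01; rewrite ler_norml; lra.
  rewrite -addrA ler_wpDr//.
    by rewrite addr_ge0 ?mulr_ge0.
  by apply: bnd; apply: discounted_reward01; rewrite lam0.
rewrite add0r.
pose e' n := lam * gap n.+1 z.
rewrite (@le_trans _ _ (2 * discounted_sum (fun k => lam * psi (t k.+1)) e' N))//.
  apply: discounted_sum_compare => n //.
  - by rewrite mulr_ge0//= ler_wpM2l.
  - by rewrite -mulrBr normrM ger0_norm// ler_wpM2l// /gap/= lerDl.
  - by rewrite -mulrBr normrM ger0_norm// ler_wpM2l// /gap/= lerDr.
rewrite (_ : 4 * lam * _ = 2 * (2 * lam * N0%:R)); last by ring.
rewrite -mulrDr ler_wpM2l//.
(* The [n]-th reward is paid at time [n.+1]. If [n >= N0], a larger gap at that time would put [z]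
   into [late_gap e N0]. *)
have gapP n : gap n.+1 z <= 2 * (n < N0)%N%:R + e * chi (t n.+1).
  have [nN0|N0n] := ltnP n N0.
    by rewrite mulr1 (@le_trans _ _ 2) ?gap_le2// lerDl mulr_ge0// /chi indicE.
  rewrite mulr0 add0r leNgt; apply/negP => bad; move: zgood.
  by rewrite notin_setE; apply; exists n.+1 => //=; exact: leqW.
rewrite (@le_trans _ _ (discounted_sum (fun k => lam * psi (t k.+1))
    (fun n => (2 * lam) * (n < N0)%N%:R + 1 * (lam * (e * chi (t n.+1)))) N))//.
  apply: le_discounted_sum => n //.
  rewrite (_ : _ + _ = lam * (2 * (n < N0)%N%:R + e * chi (t n.+1))); last by ring.
  exact: ler_wpM2l.
rewrite discounted_sum_lin mul1r lerD2r ler_wpM2l ?mulr_ge0//.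
rewrite /discounted_sum (@le_trans _ _ (\sum_(n < N) (n < N0)%N%:R))//.
  apply: ler_sum => n _; rewrite -[leRHS]mulr1 ler_wpM2l//.
  apply: prodr_ile1 => k _; rewrite subr_ge0 lpsi1 gerBl.
  by case/andP: (lpsi01 (t k.+1)).
rewrite -natr_sum ler_nat (_ : (\sum_(n < N) (n < N0))%N = minn N N0) ?geq_minr//.
by elim: (N) => [|k IH]; rewrite ?big_ord0 ?min0n// big_ord_recr /= IH; lia.
Qed.

(** Each of the three error terms is made at most [eta / 3], by the successive choice of [e], [N0]
    and [lam0]. The bound is uniform in the horizon [N]. *)
Lemma coupling_error (eta : R) : 0 < eta ->
  exists2 lam0 : R, 0 < lam0 & forall (lam : R) N, 0 < lam <= lam0 -> lam <= 1 ->
    (\int[nu \x P]_z (psi z.1 * `|J lam N (trajectory F z.1 z.2) -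
       J lam N (trajectory F y z.2)|)%:E <= eta%:E)%E.
Proof.
move=> eta0.
have nu_fin_ball s : nu (cball s) \is a fin_num.
  by rewrite ge0_fin_numE//; apply: nu_fin; exact: hX.
pose b := fine (nu (cball r)); pose c := fine (nu (cball (r + 1))).
have b0 : 0 <= b by exact: fine_ge0.
have c0 : 0 <= c by exact: fine_ge0.
(* Chosen for [2 * (e * c) <= eta / 3]; the [+ 1] keeps the denominator positive when [c = 0]. *)
pose e := eta / (6 * (c + 1)).
have e0 : 0 < e by rewrite divr_gt0// mulr_gt0// ltr_wpDl.
have eta30 : 0 < eta / 3 by rewrite divr_gt0.
have [N0 hN0] : exists N0, ((nu \x P)%E (late_gap e N0 `&` start) <= (eta / 3)%:E)%E.
  have := late_gap_small e0.
  move=> /fine_cvgP[finl] /cvgrPdist_le/(_ _ eta30)[N1 _ h].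
  have [N2 _ h2] := finl.
  exists (maxn N1 N2).
  have f : (nu \x P)%E (late_gap e (maxn N1 N2) `&` start) \is a fin_num.
    by apply: h2 => /=; exact: leq_maxr.
  have := h (maxn N1 N2) (leq_maxl _ _); rewrite /= sub0r normrN.
  rewrite ger0_norm ?fine_ge0// => hle.
  by rewrite -(fineK f) lee_fin.
(* Chosen for [4 * lam0 * N0 * b <= eta / 3], with the same precaution. *)
pose lam0 := eta / (12 * (N0%:R + 1) * (b + 1)).
have lam00 : 0 < lam0.
  by rewrite divr_gt0// !mulr_gt0// ltr_wpDl.
exists lam0 => // lam N /andP[lampos lamle] lam1.
have lam01 : 0 <= lam <= 1 by rewrite ltW.
have lpsi01 x : 0 <= lam * psi x <= 1.
  by case/andP: lam01 => l0 _; rewrite mulr_ge0//= mulr_ile1.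
pose D := discounted_path (fun x : borel X => lam * psi x)
  (fun x : borel X => lam * (e * chi x)) N.
have mchi : measurable_fun setT chi by apply: measurable_indic; exact: measurable_cball.
have mlpsi : measurable_fun setT (fun x : borel X => lam * psi x).
  exact: measurable_funM.
have mechi : measurable_fun setT (fun x : borel X => e * chi x).
  exact: measurable_funM.
have echi0 x : 0 <= e * chi x by rewrite mulr_ge0 ?(ltW e0)// /chi indicE.
have mD : measurable_fun setT D.
  by apply: measurable_discounted_path => //; exact: measurable_funM.
have D0 t : 0 <= D t.
  apply: discounted_sum_ge0 => n; first by case/andP: (lpsi01 (t n.+1)).
  by rewrite mulr_ge0// ltW.
have mtraj := measurable_trajectory F hX.
have mlate : measurable (late_gap e N0) by exact: measurable_late_gap.
pose f1 (z : borel X * Omega) : \bar R := (\1_(late_gap e N0 `&` start) z)%:E.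
pose f2 (z : borel X * Omega) : \bar R := ((4 * lam * N0%:R)%:E * (\1_start z)%:E)%E.
pose f3 (z : borel X * Omega) : \bar R :=
  (2%:E * (psi z.1 * D (trajectory F z.1 z.2))%:E)%E.
have mf1 : measurable_fun setT f1.
  by apply/measurable_EFinP; apply: measurable_indic; exact: measurableI.
have mind : measurable_fun setT (fun z => (\1_start z)%:E : \bar R).
  by apply/measurable_EFinP; exact: measurable_indic.
have mf2 : measurable_fun setT f2 by exact: measurable_funeM.
have mpsi1 : measurable_fun setT (fun z : borel X * Omega => psi z.1).
  exact: measurableT_comp mpsi measurable_fst.
have mpsiD : measurable_fun setT
    (fun z : borel X * Omega => (psi z.1 * D (trajectory F z.1 z.2))%:E).
  apply/measurable_EFinP; apply: measurable_funM => //.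
  exact: measurableT_comp mD mtraj.
have mf3 : measurable_fun setT f3 by exact: measurable_funeM.
have f10 z : (0 <= f1 z)%E by rewrite lee_fin.
have f20 z : (0 <= f2 z)%E.
  by rewrite /f2 -EFinM lee_fin mulr_ge0// !mulr_ge0// ltW.
have f30 z : (0 <= f3 z)%E by rewrite /f3 -EFinM lee_fin !mulr_ge0.
apply: (@le_trans _ _ (\int[nu \x P]_z (f1 z + f2 z + f3 z))%E).
  apply: ge0_le_integral => //.
  - by move=> z _; rewrite lee_fin mulr_ge0.
  - apply/measurable_EFinP; apply: measurable_funM => //; apply: measurableT_comp => //.
    apply: measurable_funB.
      exact: measurableT_comp (measurable_discounted_reward lam N) mtraj.
    apply: measurableT_comp (measurable_discounted_reward lam N) _.
    exact: measurableT_comp (measurable_trajectory_at F hX y) measurable_snd.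
  - by apply: emeasurable_funD => //; exact: emeasurable_funD.
  - move=> z _.
    have := discounted_reward_coupling N0 N z lam01 (ltW e0).
    set W := `|_|; rewrite -/D => WD.
    rewrite /f1 /f2 /f3 -!EFinM -!EFinD lee_fin.
    have [zr|zr] := pselect (cball r z.1); last first.
      by rewrite psi_supp// !mul0r mulr0 addr0 addr_ge0// !mulr_ge0// ltW.
    have zs : z \in start by apply: mem_set; split.
    have -> : \1_(late_gap e N0 `&` start) z = \1_(late_gap e N0) z :> R.
      by rewrite !indicE in_setI zs andbT.
    have -> : \1_start z = 1 :> R by rewrite indicE zs.
    rewrite mulr1.
    have := ler_wpM2l (psi0 z.1) WD => /le_trans; apply.
    rewrite !mulrDr (mulrCA _ 2) lerD2r lerD//.
      by rewrite ler_piMl// indicE.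
    by rewrite ler_piMl// !mulr_ge0// ltW.
rewrite ge0_integralD//; last 2 first.
- by move=> z _; exact: adde_ge0.
- exact: emeasurable_funD.
rewrite ge0_integralD// integral_indic ?setIT//; last exact: measurableI.
rewrite ge0_integralZl//; last first.
  by rewrite lee_fin !mulr_ge0// ltW.
rewrite integral_indic// [X in (_%:E * X)%E](_ : _ = b%:E); last first.
  by rewrite setIT [LHS]start_measure -(fineK (nu_fin_ball r)).
rewrite ge0_integralZl//; last by move=> z _; rewrite lee_fin mulr_ge0.
(* Here stationarity enters: however small the killing rate, the discounted visits to the larger
   ball weigh at most its measure [c]. *)
have psiD : (\int[nu \x P]_z (psi z.1 * D (trajectory F z.1 z.2))%:E <= (e * c)%:E)%E.
  rewrite -(integral_path_law F hX nu
    (G := fun t => (psi (t 0%N) * D t)%:E)); last 2 first.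
  - apply/measurable_EFinP; apply: measurable_funM => //.
    exact: measurableT_comp mpsi (@measurable_coordinate _ (borel X) 0).
  - by move=> t; rewrite lee_fin mulr_ge0.
  apply: le_trans.
    exact: (discounted_kernel_scaled_le (path_law_shift hX hF inv) N
      (ltW lampos) mpsi lpsi01 mechi echi0).
  have := path_law_at F hX nu (g := fun x => (e * chi x)%:E).
  move=> ->; last 2 first.
  - exact/measurable_EFinP.
  - by move=> x; rewrite lee_fin.
  under eq_integral do rewrite EFinM.
  rewrite ge0_integralZl//; last 3 first.
  - exact/measurable_EFinP.
  - by move=> x _; rewrite lee_fin /chi indicE.
  - by rewrite lee_fin ltW.
  rewrite integral_indic//; last exact: measurable_cball.
  have cE : nu (cball (r + 1)) = c%:E by rewrite /c fineK.
  by rewrite setIT [X in (_ * X <= _)%E]cE.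
apply: (@le_trans _ _
  ((eta / 3)%:E + (4 * lam * N0%:R)%:E * b%:E + 2%:E * (e * c)%:E)%E).
  by rewrite leeD// ?lee_wpmul2l// leeD2r.
rewrite -!EFinM -!EFinD lee_fin.
rewrite [leRHS](_ : _ = eta / 3 + eta / 3 + eta / 3); last by field.
rewrite lerD//.
  rewrite lerD2l (@le_trans _ _ (4 * lam0 * N0%:R * b))//.
    by rewrite ler_wpM2r// ler_wpM2r// ler_wpM2l.
  have N00 : 0 <= N0%:R :> R by [].
  have N11 : 0 < N0%:R + 1 :> R by rewrite ltr_wpDl.
  have b11 : 0 < b + 1 by rewrite ltr_wpDl.
  rewrite (_ : 4 * lam0 * _ * b = eta / 3 * ((N0%:R / (N0%:R + 1)) * (b / (b + 1)))).
    rewrite ler_piMr ?(ltW eta30)// mulr_ile1 ?divr_ge0 ?(ltW N11) ?(ltW b11)//;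
      by rewrite ler_pdivrMr// mul1r lerDl.
  by rewrite /lam0; field; rewrite !gt_eqF.
have c11 : 0 < c + 1 by rewrite ltr_wpDl.
rewrite (_ : 2 * _ = eta / 3 * (c / (c + 1))); last first.
  by rewrite /e; field; rewrite gt_eqF.
by rewrite ler_piMr ?(ltW eta30)// ler_pdivrMr// mul1r lerDl.
Qed.

End coupling_error.

(** * The limit of the mean reward from an arbitrary point *)

Section starting_point_free_limit.
Context (R : realType) (X : pmetricType R) (mu : probability (borel (cmap X)) R)
  (d : measure_display) (Omega : measurableType d) (P : probability Omega R)
  (F : nat -> {RV P >-> borel (cmap X)}).
Hypothesis hX : proper_metric X.
Hypothesis hF : iid_with_law mu F.
Hypothesis hlc : locally_contractive P F.
Hypothesis hrec : recurrent P F.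
Variables (psi phi : X -> R) (r : R) (y : X).
Hypotheses (cpsi : continuous psi) (cphi : continuous phi).
Hypothesis phipsi : forall x, 0 <= phi x <= psi x.
Hypothesis psi1 : forall x, psi x <= 1.
Hypothesis psi_supp : forall x, ~ cball r x -> psi x = 0.

Let phi0 x : 0 <= phi x. Proof. by case/andP: (phipsi x). Qed.
Let phi_le x : phi x <= psi x. Proof. by case/andP: (phipsi x). Qed.
Let psi0 x : 0 <= psi x. Proof. exact: le_trans (phi0 x) (phi_le x). Qed.
Let mpsi : measurable_fun setT (psi : borel X -> R).
Proof. exact: continuous_borel_measurable. Qed.
Let mphi : measurable_fun setT (phi : borel X -> R).
Proof. exact: continuous_borel_measurable. Qed.

Local Notation J := (@discounted_reward R X psi phi).

Let reward01 (lam : R) N w : 0 <= lam <= 1 -> 0 <= J lam N (trajectory F y w) <= 1.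
Proof. exact: discounted_reward01. Qed.

(** No invariant measure occurs in this number, which is why it can link two of them. *)
Definition mean_reward (lam : R) N : R :=
  fine (\int[P]_w (J lam N (trajectory F y w))%:E)%E.

Lemma mean_rewardE (lam : R) N : 0 <= lam <= 1 ->
  (\int[P]_w (J lam N (trajectory F y w))%:E = (mean_reward lam N)%:E)%E.
Proof.
move=> lam01; rewrite fineK// ge0_fin_numE; last first.
  by apply: integral_ge0 => w _; rewrite lee_fin; case/andP: (reward01 N w lam01).
apply: (@le_lt_trans _ _ (\int[P]_w (1%:E))%E); last first.
  by rewrite integral_cst// [X in (_ * X)%E](@probability_setT _ _ _ P) mule1 ltry.
apply: ge0_le_integral => //.
- by move=> w _; rewrite lee_fin; case/andP: (reward01 N w lam01).
- apply/measurable_EFinP.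
  exact: measurableT_comp (measurable_discounted_reward cpsi cphi lam N)
    (measurable_trajectory_at F hX y).
- by move=> w _; rewrite lee_fin; case/andP: (reward01 N w lam01).
Qed.

Section one_measure.
Variable nu : {sigma_finite_measure set (borel X) -> \bar R}.
Hypothesis inv : forall U : set (borel X), measurable U ->
  nu U = (\int[nu]_x transition P F x U)%E.
Hypothesis nu_fin : forall K : set X, compact K -> (nu K < +oo)%E.

Lemma integral_supp_fin (f : X -> R) : continuous f ->
  (forall x, 0 <= f x <= psi x) -> (\int[nu]_x (f x)%:E)%E \is a fin_num.
Proof.
move=> cf f01; have mf : measurable_fun setT (f : borel X -> R).
  exact: continuous_borel_measurable.
rewrite ge0_fin_numE; last first.
  by apply: integral_ge0 => x _; rewrite lee_fin; case/andP: (f01 x).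
apply: (@le_lt_trans _ _ (\int[nu]_x (\1_(cball r) x)%:E)%E); last first.
  rewrite integral_indic ?setIT; first exact: nu_fin (hX (x := point) (r := r)).
    by [].
  exact: measurable_cball.
apply: ge0_le_integral => //.
- by move=> x _; rewrite lee_fin; case/andP: (f01 x).
- exact/measurable_EFinP.
- by apply/measurable_EFinP; apply: measurable_indic; exact: measurable_cball.
- move=> x _; rewrite lee_fin indicE; case/andP: (f01 x) => _ fx.
  have [xr|xr] := boolP (x \in cball r); first exact: le_trans fx (psi1 x).
  by rewrite (le_trans fx)// psi_supp//; move: xr; rewrite notin_setE.
Qed.

(** With reward collected from [x], the integral against [psi dnu] tends to the integral of [phi];
    with reward collected from [y], it factorises. The coupling error bounds the difference of the
    two. *)
Lemma mean_reward_limit (eta : R) : 0 < eta ->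
  exists2 lam0 : R, 0 < lam0 & forall lam : R, 0 < lam <= lam0 -> lam <= 1 ->
    \forall N \near \oo,
      `|fine (\int[nu]_x (phi x)%:E)%E -
        fine (\int[nu]_x (psi x)%:E)%E * mean_reward lam N| <= eta.
Proof.
move=> eta0; have eta20 : 0 < eta / 2 by rewrite divr_gt0.
have finphi := integral_supp_fin cphi phipsi.
have finpsi : (\int[nu]_x (psi x)%:E)%E \is a fin_num.
  by apply: integral_supp_fin => // x; rewrite psi0 lexx.
have [lam0 lam00 err] :=
  coupling_error hX hF hlc inv nu_fin y cpsi cphi phipsi psi1 psi_supp eta20.
exists lam0 => // lam lamb lam1; have /andP[lampos lamle] := lamb.
have lam01 : 0 <= lam <= 1 by rewrite ltW.
have minv := path_law_shift hX hF inv.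
have cvgJ := discounted_kernel_cvg minv (fun s : nat => measurable_cball s%:R)
  (path_law_cball_fin F hX nu_fin) (path_law_recurrent hX hrec nu)
  lampos lam1 mpsi mphi phipsi psi1.
have {cvgJ} : (\int[path_law F hX nu]_t (psi (t 0%N) * J lam N t)%:E @[N --> \oo]
    --> \int[nu]_x (phi x)%:E)%E.
  rewrite -(path_law_at F hX nu (g := fun x => (phi x)%:E)); last 2 first.
  - exact/measurable_EFinP.
  - by move=> x; rewrite lee_fin.
  apply: cvgJ; rewrite (path_law_at F hX nu (g := fun x => (psi x)%:E)); last 2 first.
  - exact/measurable_EFinP.
  - by move=> x; rewrite lee_fin.
  by rewrite -ge0_fin_numE//; apply: integral_ge0 => x _; rewrite lee_fin.
rewrite -(fineK finphi) => /fine_cvgP[finJ /cvgrPdist_le/(_ _ eta20) closeJ].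
have mtraj := measurable_trajectory F hX.
have mJ N := measurable_discounted_reward cpsi cphi lam N.
have mpsi1 : measurable_fun setT (fun z : borel X * Omega => psi z.1).
  exact: measurableT_comp mpsi measurable_fst.
near=> N.
set a := fine _; set b := fine _; set c := mean_reward _ _.
pose Jx (z : borel X * Omega) := J lam N (trajectory F z.1 z.2).
pose Jy (z : borel X * Omega) := J lam N (trajectory F y z.2).
have mJx : measurable_fun setT Jx by exact: measurableT_comp (mJ N) mtraj.
have mJy : measurable_fun setT Jy.
  apply: measurableT_comp (mJ N) _.
  exact: measurableT_comp (measurable_trajectory_at F hX y) measurable_snd.
have Jx01 z : 0 <= Jx z <= 1 by exact: discounted_reward01.
have Jy01 z : 0 <= Jy z <= 1 by exact: discounted_reward01.
have Jx0 z : 0 <= Jx z by case/andP: (Jx01 z).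
have Jy0 z : 0 <= Jy z by case/andP: (Jy01 z).
pose I1 := (\int[nu \x P]_z (psi z.1 * Jx z)%:E)%E.
pose I2 := (\int[nu \x P]_z (psi z.1 * Jy z)%:E)%E.
pose E := (\int[nu \x P]_z (psi z.1 * `|Jx z - Jy z|)%:E)%E.
have mI (f : borel X * Omega -> R) : measurable_fun setT f ->
    measurable_fun setT (fun z : borel X * Omega => (psi z.1 * f z)%:E).
  by move=> mf; apply/measurable_EFinP; exact: measurable_funM.
have mdiff : measurable_fun setT (fun z => `|Jx z - Jy z|).
  by apply: measurableT_comp => //; exact: measurable_funB.
have I1E : I1 = (\int[path_law F hX nu]_t (psi (t 0%N) * J lam N t)%:E)%E.
  rewrite (integral_path_law F hX nu (G := fun t => (psi (t 0%N) * J lam N t)%:E))//.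
  - apply/measurable_EFinP; apply: measurable_funM => //.
    exact: measurableT_comp mpsi (@measurable_coordinate _ (borel X) 0).
  - move=> t; rewrite lee_fin mulr_ge0//.
    by case/andP: (discounted_reward01 phipsi psi1 N t lam01).
have fI1 : I1 \is a fin_num by rewrite I1E; near: N.
have I1a : `|a - fine I1| <= eta / 2 by rewrite I1E; near: N.
(* The trajectory from [y] does not involve [x], so the double integral is a product. *)
have I2E : I2 = (b * c)%:E.
  rewrite /I2 (fubini_tonelli1
    (fun z : borel X * Omega => (psi z.1 * Jy z)%:E)); last 2 first.
  - exact: mI.
  - by move=> z; rewrite lee_fin mulr_ge0.
  rewrite EFinM /b fineK// -mean_rewardE// -ge0_integralZr//; last 3 first.
  - exact/measurable_EFinP.
  - by move=> x _; rewrite lee_fin.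
  - by apply: integral_ge0 => w _; rewrite lee_fin; case/andP: (reward01 N w lam01).
  apply: eq_integral => x _; rewrite /fubini_F /=.
  under eq_integral do rewrite EFinM.
  rewrite ge0_integralZl//.
  - apply/measurable_EFinP.
    exact: measurableT_comp (mJ N) (measurable_trajectory_at F hX y).
  - by move=> w _; rewrite lee_fin; case/andP: (reward01 N w lam01).
  - by rewrite lee_fin.
have fI2 : I2 \is a fin_num by rewrite I2E.
have Eeta : (E <= (eta / 2)%:E)%E by exact: err.
have I12 : (I1 <= I2 + E)%E.
  rewrite -ge0_integralD//; try exact: mI.
  - apply: ge0_le_integral => //; [|exact: mI|apply: emeasurable_funD; exact: mI|].
      by move=> z _; rewrite lee_fin mulr_ge0.
    move=> z _; rewrite -EFinD lee_fin -mulrDr ler_wpM2l//.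
    by rewrite -lerBlDl ler_norm.
  - by move=> z _; rewrite lee_fin mulr_ge0.
  - by move=> z _; rewrite lee_fin mulr_ge0.
have I21 : (I2 <= I1 + E)%E.
  rewrite -ge0_integralD//; try exact: mI.
  - apply: ge0_le_integral => //; [|exact: mI|apply: emeasurable_funD; exact: mI|].
      by move=> z _; rewrite lee_fin mulr_ge0.
    move=> z _; rewrite -EFinD lee_fin -mulrDr ler_wpM2l//.
    by rewrite -lerBlDl distrC ler_norm.
  - by move=> z _; rewrite lee_fin mulr_ge0.
  - by move=> z _; rewrite lee_fin mulr_ge0.
have {}I12 : (I1 <= I2 + (eta / 2)%:E)%E by rewrite (le_trans I12)// leeD2l.
have {}I21 : (I2 <= I1 + (eta / 2)%:E)%E by rewrite (le_trans I21)// leeD2l.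
move: I12 I21; rewrite I2E -(fineK fI1) -!EFinD !lee_fin => I12 I21.
move: I1a; rewrite !ler_norml => /andP[h1 h2].
by apply/andP; split; lra.
Unshelve. all: by end_near. Qed.

End one_measure.
End starting_point_free_limit.

(** * Uniqueness of the invariant measure *)

Section compact_sets.
Context (R : realType) (X : pmetricType R).
Hypothesis hX : proper_metric X.

Lemma compact_sub_cball (K : set X) : compact K -> exists r : R, K `<=` cball r.
Proof.
move=> /compact_near_coveringP cK.
have near_bound : \forall n \near \oo, K `<=` (fun x => mdist point x <= n%:R).
  apply: cK => x Kx; pose n := (Num.truncn (mdist point x + 1)).+1.
  exists ([set z | mdist x z < 1], [set k | (n <= k)%N]) => /=.
    split; last by exists n.
    by apply/nbhs_ballP; exists 1 => //=; rewrite ballEmdist.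
  move=> [z k] /= [xz nk]; rewrite (@le_trans _ _ n%:R) ?ler_nat//.
  rewrite (le_trans (metric_triangle _ x _))//.
  by rewrite (@le_trans _ _ (mdist point x + 1)) ?lerD2l// ltW// truncnS_gt.
by case: near_bound => n _ /(_ n (leqnn n)) Kn; exists n%:R.
Qed.

(** Urysohn functions equal to [1] on [K] and to [0] off its neighbourhood of radius [1/(n+1)].
    These radii are at most [1], so one ball of radius [r + 1] contains all the supports. *)
Lemma compact_indicator_approx (K : set X) : compact K ->
  exists (r : R) (f : nat -> X -> R),
    [/\ forall n, continuous (f n),
        forall n x, 0 <= f n x <= 1,
        forall n x, ~ cball r x -> f n x = 0,
        forall n x, K x -> f n x = 1 &
        forall x, f n x @[n --> \oo] --> (\1_K x : R)].
Proof.
move=> cK; have [r Kr] := compact_sub_cball cK.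
have clK : closed K by apply: compact_closed => //; exact: metric_hausdorff.
pose U n := \bigcup_(k in K) [set x | mdist k x < n.+1%:R^-1].
have oU n : open (U n) by apply: bigcup_open => k _; exact: open_mball.
pose f n : X -> R := Urysohn (~` U n) K.
have sep n : uniform_separator (~` U n) K.
  apply: normal_uniform_separator => //.
  - exact: pseudometric_normal.
  - exact: open_closedC.
  - rewrite -subset0 => x [nUx Kx]; apply: nUx; exists x => //=.
    by rewrite mdistxx invr_gt0.
have f0 n x : ~ U n x -> f n x = 0.
  by move=> nU; apply: (Urysohn_sub0 (sep n)); exists x.
have f1 n x : K x -> f n x = 1.
  by move=> Kx; apply: (Urysohn_sub1 (sep n)); exists x.
exists (r + 1), f; split=> //.
- by move=> n; exact: Urysohn_continuous.
- move=> n x; have := @Urysohn_range _ R (~` U n) K (f n x).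
  by rewrite /= in_itv /=; apply; exists x.
- move=> n x nr; apply: f0 => -[k /Kr /= kr kx]; apply: nr; rewrite /cball /=.
  rewrite (le_trans (metric_triangle _ k _))// lerD// ltW//.
  by rewrite (lt_le_trans kx)// invf_le1// ler1n.
- move=> x; rewrite indicE; have [xK|xK] := boolP (x \in K).
    apply: cvg_near_cst; apply: nearW => n; apply: f1; exact: set_mem.
  have : nbhs x (~` K).
    apply: open_nbhs_nbhs; split; first exact: closed_openC.
    by move: xK; rewrite notin_setE.
  move=> /nbhs_ballP[e /= e0]; rewrite ballEmdist => eK.
  have [N _ hN] := near_infty_natSinv_lt (PosNum e0).
  apply: cvg_near_cst; exists N => // n /= Nn; apply: f0 => -[k Kk /= kx].
  apply: (eK k) => //=; rewrite metric_sym (lt_trans kx)//.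
  exact: hN.
Qed.

(** The complement of an open set is the union of its compact intersections with the integer
    balls. *)
Lemma borel_generated_by_compact :
  @measurable _ (borel X) = <<s @compact X >>.
Proof.
apply/seteqP; split; apply: smallest_sub; try exact: smallest_sigma_algebra.
- move=> U oU.
  have -> : U = setT `\` \bigcup_(n : nat) (~` U `&` cball n%:R).
    by rewrite -setI_bigcupr bigcup_cball setIT setTD setCK.
  apply: sigma_algebraCD; apply: sigma_algebra_bigcup => n.
  apply: sub_sigma_algebra; apply: subclosed_compact (hX (x := point) (r := n%:R)) _.
    by apply: closedI; [exact: open_closedC|exact: closed_mball].
  exact: subIsetr.
- move=> K cK; apply: measurable_closed; apply: compact_closed => //.
  exact: metric_hausdorff.
Qed.

Lemma compact_measure_unique (m1 m2 : {measure set (borel X) -> \bar R}) :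
  (forall K : set X, compact K -> m1 K = m2 K) ->
  (forall K : set X, compact K -> (m1 K < +oo)%E) ->
  forall U, measurable U -> m1 U = m2 U.
Proof.
move=> m12 fin U mU.
have cl (K : set X) : compact K -> closed K.
  by apply: compact_closed; exact: metric_hausdorff.
have cI (K1 K2 : set X) : compact K1 -> compact K2 -> compact (K1 `&` K2).
  move=> c1 c2; apply: subclosed_compact (c1) _; last exact: subIsetl.
  by apply: closedI; [exact: cl c1|exact: cl c2].
apply: (@measure_unique _ R (borel X) (@compact X) (fun n => cball n%:R)) => //.
- exact: borel_generated_by_compact.
- by move=> n; exact: hX.
- exact: bigcup_cball.
- by move=> n; apply: fin; exact: hX.
Qed.

Lemma measure_compact_cvg (m : {measure set (borel X) -> \bar R}) (K : set X)
    (r : R) (f : nat -> X -> R) :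
  compact K -> (m (cball r) < +oo)%E -> (forall n, continuous (f n)) ->
  (forall n x, 0 <= f n x <= 1) -> (forall n x, ~ cball r x -> f n x = 0) ->
  (forall x, f n x @[n --> \oo] --> (\1_K x : R)) ->
  (\int[m]_x (f n x)%:E @[n --> \oo] --> m K)%E.
Proof.
move=> cK fin cf f01 fsupp fK.
have mK : measurable (K : set (borel X)).
  by apply: measurable_closed; apply: compact_closed => //; exact: metric_hausdorff.
rewrite -[X in _ --> X](_ : \int[m]_x (\1_K x)%:E = _)%E; last first.
  by rewrite integral_indic// setIT.
have [|||||_ _ //] := @dominated_convergence _ (borel X) _ m setT measurableT
    (fun n x => (f n x)%:E) (fun x => (\1_K x)%:E) (fun x => (\1_(cball r) x)%:E).
- by move=> n; apply/measurable_EFinP; exact: continuous_borel_measurable.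
- by apply/measurable_EFinP; exact: measurable_indic.
- by apply: aeW => x _; apply: cvg_EFin; [exact: nearW|exact: fK].
- apply/integrableP; split.
    by apply/measurable_EFinP; apply: measurable_indic; exact: measurable_cball.
  under eq_integral do rewrite gee0_abs ?lee_fin//.
  by rewrite integral_indic ?setIT//; exact: measurable_cball.
- apply: aeW => x n _; rewrite gee0_abs ?lee_fin; last by case/andP: (f01 n x).
  rewrite indicE; have [xr|xr] := boolP (x \in cball r); first by case/andP: (f01 n x).
  by rewrite fsupp//; move: xr; rewrite notin_setE.
Qed.

End compact_sets.

Section uniqueness.
Context (R : realType) (X : pmetricType R) (mu : probability (borel (cmap X)) R)
  (d : measure_display) (Omega : measurableType d) (P : probability Omega R)
  (F : nat -> {RV P >-> borel (cmap X)}).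
Hypothesis hX : proper_metric X.
Hypothesis hF : iid_with_law mu F.
Hypothesis hlc : locally_contractive P F.
Hypothesis hrec : recurrent P F.
Variables nu1 nu2 : {sigma_finite_measure set (borel X) -> \bar R}.
Hypothesis inv1 : forall U : set (borel X), measurable U ->
  nu1 U = (\int[nu1]_x transition P F x U)%E.
Hypothesis fin1 : forall K : set X, compact K -> (nu1 K < +oo)%E.
Hypothesis inv2 : forall U : set (borel X), measurable U ->
  nu2 U = (\int[nu2]_x transition P F x U)%E.
Hypothesis fin2 : forall K : set X, compact K -> (nu2 K < +oo)%E.

(** Both measures are compared with the same [mean_reward], for a common small [lam] and large [N].
    The multiplied form avoids dividing by integrals of [psi], which may vanish. *)
Lemma integral_cross_ratio (psi phi : X -> R) (r : R) :
  continuous psi -> continuous phi -> (forall x, 0 <= phi x <= psi x) ->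
  (forall x, psi x <= 1) -> (forall x, ~ cball r x -> psi x = 0) ->
  fine (\int[nu1]_x (phi x)%:E)%E * fine (\int[nu2]_x (psi x)%:E)%E =
  fine (\int[nu2]_x (phi x)%:E)%E * fine (\int[nu1]_x (psi x)%:E)%E.
Proof.
move=> cpsi cphi phipsi psi1 psi_supp.
set a1 := fine (\int[nu1]_x (phi x)%:E)%E; set b1 := fine (\int[nu1]_x (psi x)%:E)%E.
set a2 := fine (\int[nu2]_x (phi x)%:E)%E; set b2 := fine (\int[nu2]_x (psi x)%:E)%E.
have psi0 x : 0 <= psi x by case/andP: (phipsi x); exact: le_trans.
have b10 : 0 <= b1 by apply: fine_ge0; apply: integral_ge0 => x _; rewrite lee_fin.
have b20 : 0 <= b2 by apply: fine_ge0; apply: integral_ge0 => x _; rewrite lee_fin.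
apply/eqP; rewrite -subr_eq0 -normr_le0; apply/ler_addgt0Pl => e e0; rewrite addr0.
pose eta := e / (b1 + b2 + 1).
have eta0 : 0 < eta by rewrite divr_gt0// ltr_wpDl// addr_ge0.
have [l1 l10 h1] := mean_reward_limit hX hF hlc hrec point cpsi cphi phipsi
  psi1 psi_supp inv1 fin1 eta0.
have [l2 l20 h2] := mean_reward_limit hX hF hlc hrec point cpsi cphi phipsi
  psi1 psi_supp inv2 fin2 eta0.
pose lam := Num.min (Num.min l1 l2) 1.
have lam0 : 0 < lam by rewrite !lt_min l10 l20 ltr01.
have laml1 : 0 < lam <= l1 by rewrite lam0 !ge_min lexx.
have laml2 : 0 < lam <= l2 by rewrite lam0 !ge_min lexx orbT.
have lam1 : lam <= 1 by rewrite ge_min lexx orbT.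
have [N [hN1 hN2]] := filter_ex (filterI (h1 _ laml1 lam1) (h2 _ laml2 lam1)).
move: hN1 hN2; rewrite -/a1 -/b1 -/a2 -/b2; set M := mean_reward _ _ _ _ _ _ => hN1 hN2.
(* The common mean reward [M] cancels. *)
have -> : a1 * b2 - a2 * b1 = (a1 - b1 * M) * b2 - (a2 - b2 * M) * b1 by ring.
rewrite (le_trans (ler_normB _ _))// !normrM (ger0_norm b10) (ger0_norm b20).
rewrite (@le_trans _ _ (eta * b2 + eta * b1))//.
  by rewrite lerD// ler_wpM2r.
rewrite -mulrDr /eta mulrAC ler_pdivrMr ?ler_wpM2l ?(ltW e0)//; first by lra.
by rewrite ltr_wpDl// addr_ge0.
Qed.

(** The constant is read off a fixed reference function [psi0] with positive [nu1]-integral. It may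
    be [0]: [nu2] is allowed to vanish, as does the measure carried by a null invariant event. *)
Theorem invariant_measure_unique : nu1 setT != 0%E ->
  exists2 c : R, 0 <= c &
    forall U : set (borel X), measurable U -> nu2 U = (c%:E * nu1 U)%E.
Proof.
move=> nu1T.
have [k nu1k] := cball_measure_neq0 nu1T.
have [r0 [f0 [cf0 f001 f0supp f0K _]]] := compact_indicator_approx
  (hX (x := point) (r := k%:R)).
pose psi0 := f0 0%N.
have cpsi0 : continuous psi0 by exact: cf0.
have psi0_ge0 x : 0 <= psi0 x by case/andP: (f001 0%N x).
have psi0_le1 x : psi0 x <= 1 by case/andP: (f001 0%N x).
have psi0_01 x : 0 <= psi0 x <= psi0 x by rewrite psi0_ge0 lexx.
have fin_psi0 := integral_supp_fin hX psi0_le1 (f0supp 0%N) fin1 cpsi0 psi0_01.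
pose B1 := fine (\int[nu1]_x (psi0 x)%:E)%E.
pose B2 := fine (\int[nu2]_x (psi0 x)%:E)%E.
have B10 : 0 < B1.
  rewrite fine_gt0// -ge0_fin_numE ?fin_psi0 ?andbT//; last first.
    by apply: integral_ge0 => x _; rewrite lee_fin.
  rewrite (@lt_le_trans _ _ (nu1 (cball k%:R)))//.
    by rewrite lt_def nu1k measure_ge0.
  rewrite -[leLHS](_ : \int[nu1]_x (\1_(cball k%:R) x)%:E = _)%E; last first.
    by rewrite integral_indic ?setIT//; exact: measurable_cball.
  apply: ge0_le_integral => //.
  - by apply/measurable_EFinP; apply: measurable_indic; exact: measurable_cball.
  - by apply/measurable_EFinP; exact: continuous_borel_measurable.
  - move=> x _; rewrite lee_fin indicE; have [xk|//] := boolP (x \in cball k%:R).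
    by rewrite /psi0 f0K//; exact: set_mem.
have B20 : 0 <= B2.
  by apply: fine_ge0; apply: integral_ge0 => x _; rewrite lee_fin.
pose c := B2 / B1.
have c0 : 0 <= c by rewrite divr_ge0// ltW.
exists c => // U mU.
have test_eq (phi : X -> R) (r : R) : continuous phi -> (forall x, 0 <= phi x <= 1) ->
    (forall x, ~ cball r x -> phi x = 0) ->
    (\int[nu2]_x (phi x)%:E = c%:E * \int[nu1]_x (phi x)%:E)%E.
  move=> cphi phi01 phi_supp.
  (* The ratio formula needs a dominating function; the maximum dominates both [phi] and [psi0] and
     thus links their integrals. *)
  pose psi x := Num.max (phi x) (psi0 x); pose s := Num.max r r0.
  have cpsi : continuous psi.
    by move=> x; apply: continuous_max; [exact: cphi|exact: cpsi0].
  have phi0 x : 0 <= phi x by case/andP: (phi01 x).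
  have phipsi x : 0 <= phi x <= psi x by rewrite phi0 le_max lexx.
  have psi0psi x : 0 <= psi0 x <= psi x by rewrite psi0_ge0 le_max lexx orbT.
  have psi1 x : psi x <= 1 by rewrite ge_max psi0_le1 andbT; case/andP: (phi01 x).
  have psi_supp x : ~ cball s x -> psi x = 0.
    move=> ns; rewrite /psi phi_supp ?/psi0 ?f0supp ?maxxx// => h; apply: ns;
      by rewrite /cball /= le_max h ?orbT.
  have := integral_cross_ratio cpsi cphi phipsi psi1 psi_supp.
  have := integral_cross_ratio cpsi cpsi0 psi0psi psi1 psi_supp.
  have fphi1 := integral_supp_fin hX psi1 psi_supp fin1 cphi phipsi.
  have fphi2 := integral_supp_fin hX psi1 psi_supp fin2 cphi phipsi.
  have psipsi x : 0 <= psi x <= psi x.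
    by rewrite lexx (le_trans (phi0 x))//; case/andP: (phipsi x).
  have fpsi1 := integral_supp_fin hX psi1 psi_supp fin1 cpsi psipsi.
  rewrite -/B1 -/B2 -(fineK fphi1) -(fineK fphi2).
  set C1 := fine (\int[nu1]_x (psi x)%:E)%E; set C2 := fine (\int[nu2]_x (psi x)%:E)%E.
  rewrite ![fine (EFin _)]/=.
  set A1 := fine (\int[nu1]_x (phi x)%:E)%E; set A2 := fine (\int[nu2]_x (phi x)%:E)%E.
  move=> e0 e1; rewrite -EFinM; congr EFin.
  have C10 : 0 < C1.
    apply: (lt_le_trans B10); apply: fine_le; [exact: fin_psi0|exact: fpsi1|].
    apply: ge0_le_integral => //.
    - by move=> x _; rewrite lee_fin.
    - by apply/measurable_EFinP; exact: continuous_borel_measurable.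
    - by apply/measurable_EFinP; exact: continuous_borel_measurable.
    - by move=> x _; rewrite lee_fin; case/andP: (psi0psi x).
  have C1n : C1 != 0 by rewrite gt_eqF.
  have B1n : B1 != 0 by rewrite gt_eqF.
  apply: (mulIf C1n); rewrite -e1 /c.
  by rewrite (_ : C2 = B2 * C1 / B1); [field|rewrite -e0; field].
pose m2 : {measure set (borel X) -> \bar R} := mscale (NngNum c0) nu1.
have -> : (c%:E * nu1 U = m2 U)%E by [].
apply: (compact_measure_unique hX (m2 := m2)) => // K cK.
have [r [f [cf f01 fsupp fK fcvg]]] := compact_indicator_approx cK.
have cvg2 := measure_compact_cvg cK (fin2 (hX (x := point) (r := r))) cf f01 fsupp fcvg.
have cvg1 := measure_compact_cvg cK (fin1 (hX (x := point) (r := r))) cf f01 fsupp fcvg.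
have fK1 : nu1 K \is a fin_num by rewrite ge0_fin_numE//; exact: fin1.
have cvg2' : (\int[nu2]_x (f n x)%:E @[n --> \oo] --> c%:E * nu1 K)%E.
  rewrite (_ : (fun n => _) = (fun n => c%:E * \int[nu1]_x (f n x)%:E)%E).
    exact: cvgeZl.
  apply/funext => n; exact: (test_eq (f n) r (cf n) (f01 n) (fsupp n)).
exact: (cvg_unique (@ereal_hausdorff R) cvg2 cvg2').
Qed.

End uniqueness.

(** * Shift-invariant events *)

Section iterated_expectations.
Context (R : realType) (X : pmetricType R) (mu : probability (borel (cmap X)) R)
  (d : measure_display) (Omega : measurableType d) (P : probability Omega R)
  (F : nat -> {RV P >-> borel (cmap X)}).
Hypothesis hX : proper_metric X.
Hypothesis hF : iid_with_law mu F.
Local Open Scope ereal_scope.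

(** Both sides integrate [G] against image measures on the path space, which agree on events by
    [Pr_from_shift]. *)
Lemma integral_markov (x : X) (G : seqspace (borel X) -> \bar R) :
  measurable_fun setT G -> (forall t, 0 <= G t) ->
  \int[P]_w G (shiftn 1 (trajectory F x w : seqspace (borel X))) =
  \int[P]_w \int[P]_w' G (trajectory F (sds F x 1 w) w').
Proof.
move=> mG G0.
pose f w : seqspace (borel X) := shiftn 1 (trajectory F x w : seqspace (borel X)).
pose g (z : Omega * Omega) : seqspace (borel X) := trajectory F (sds F x 1 z.1) z.2.
have mf : measurable_fun setT f.
  exact: measurableT_comp (measurable_shiftn 1) (measurable_trajectory_at F hX x).
have mg : measurable_fun setT g.
  have : measurable_fun setT (fun z : Omega * Omega => (sds F x 1 z.1 : borel X, z.2)).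
    apply: measurable_fun_pair => //.
    exact: measurableT_comp (measurable_sds_at F hX x 1) measurable_fst.
  by move=> /(measurableT_comp (measurable_trajectory F hX)).
transitivity (\int[pushforward P f]_t G t).
  by rewrite ge0_integral_pushforward// preimage_setT.
transitivity (\int[pushforward (P \x P) g]_t G t); last first.
  rewrite ge0_integral_pushforward// preimage_setT (fubini_tonelli1 (G \o g))//.
    exact: measurableT_comp mG mg.
  by move=> z /=.
apply: (@eq_measure_integral _ _ _ _
  (pushforward_measure (P \x P) mg)
  (pushforward_measure P mf)).
move=> A mA _; transitivity (\int[P]_w Pr_from P F (sds F x 1 w) A).
  exact: (Pr_from_shift hX hF x mA).
rewrite /= /pushforward /product_measure1 /=; apply: eq_integral => w _.
by rewrite /Pr_from /pushforward; congr (P _); apply/seteqP; split => w' /=;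
  rewrite xsectionE.
Qed.

(** The [n]-th iterate of the transition operator. *)
Definition expectation_at n (g : X -> \bar R) (x : X) : \bar R :=
  \int[P]_w g (sds F x n w).

Local Notation En := expectation_at.

Lemma expectation_at0 g x : En 0 g x = g x.
Proof.
by rewrite /expectation_at (integral_cst P measurableT (g x))
  [X in (_ * X)](@probability_setT _ _ _ P) mule1.
Qed.

Lemma expectation_at_ge0 n g x : (forall y, 0 <= g y) -> 0 <= En n g x.
Proof. by move=> g0; apply: integral_ge0. Qed.

Lemma measurable_expectation_at n (g : borel X -> \bar R) :
  measurable_fun setT g -> (forall y, 0 <= g y) ->
  measurable_fun setT (En n g : borel X -> \bar R).
Proof.
move=> mg g0; have := measurable_fun_fubini_tonelli_F (m2 := P)
  (fun z : borel X * Omega => g (sds F z.1 n z.2)).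
apply => //; exact: measurableT_comp mg (measurable_sds F hX n).
Qed.

Lemma expectation_atS n (g : borel X -> \bar R) x :
  measurable_fun setT g -> (forall y, 0 <= g y) ->
  En n.+1 g x = En 1 (En n g) x.
Proof.
move=> mg g0.
rewrite -[RHS](integral_markov x (G := fun t => g (t n)))//.
exact: measurableT_comp mg (@measurable_coordinate _ (borel X) n).
Qed.

(** The last step is split off instead of the first; powers of one operator commute. *)
Lemma expectation_atSr n (g : borel X -> \bar R) x :
  measurable_fun setT g -> (forall y, 0 <= g y) ->
  En n.+1 g x = En n (En 1 g) x.
Proof.
move=> mg g0; elim: n x => [|n IHn] x; first by rewrite expectation_at0.
rewrite expectation_atS// [RHS]expectation_atS//.
- by apply: eq_integral => w _; exact: IHn.
- exact: measurable_expectation_at.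
- by move=> y; exact: expectation_at_ge0.
Qed.

End iterated_expectations.

(** * The probability of an invariant event as a bounded martingale *)

Section invariant_event.
Context (R : realType) (X : pmetricType R) (mu : probability (borel (cmap X)) R)
  (d : measure_display) (Omega : measurableType d) (P : probability Omega R)
  (F : nat -> {RV P >-> borel (cmap X)}).
Hypothesis hX : proper_metric X.
Hypothesis hF : iid_with_law mu F.
Variable A : set (seqspace (borel X)).
Hypothesis mA : measurable A.
Hypothesis hA : shiftn 1 @^-1` A = A.
Local Open Scope ereal_scope.

Local Notation En := (expectation_at F).

Definition event_prob (x : X) : R := fine (Pr_from P F x A).
Local Notation h := event_prob.

Lemma event_probE x : Pr_from P F x A = (h x)%:E.
Proof.
rewrite fineK// ge0_fin_numE ?Pr_from_ge0//.
by rewrite (le_lt_trans (Pr_from_le1 F hX x mA))// ltry.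
Qed.

Lemma event_prob_ge0 x : (0 <= h x)%R.
Proof. by apply: fine_ge0; exact: Pr_from_ge0. Qed.

Lemma event_prob_le1 x : (h x <= 1)%R.
Proof. by rewrite -lee_fin -event_probE; exact: (Pr_from_le1 F hX x mA). Qed.

Lemma measurable_event_prob : measurable_fun setT (h : borel X -> R).
Proof.
apply/measurable_EFinP; have := measurable_Pr_from F hX mA.
by congr measurable_fun; apply/funext => x; exact: event_probE.
Qed.

Lemma event_prob_harmonic x : \int[P]_w (h (sds F x 1 w))%:E = (h x)%:E.
Proof.
rewrite -event_probE -{1}hA (Pr_from_shift hX hF x mA).
by apply: eq_integral => w _; rewrite event_probE.
Qed.

(** Given the first [n.+1] positions, the conditional probability of the invariant event is
    [h (X_n)]. The induction peels off the initial coordinate. *)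
Lemma event_box_markov n (B : nat -> set (borel X)) x :
  (forall k, measurable (B k)) ->
  Pr_from P F x (box n B `&` A) =
  \int[P]_w (\1_(box n B) (trajectory F x w) * h (sds F x n w))%:E.
Proof.
elim: n B x => [|n IHn] B x mB.
  have -> : box 0 B `&` A = [set t | B 0%N (t 0%N)] `&` (shiftn 1 @^-1` A).
    rewrite hA; congr (_ `&` _).
    by apply/seteqP; split=> t; [exact|move=> tB [|k]].
  rewrite (Pr_from_markov hX hF _ _ mA).
  under eq_integral do rewrite event_probE.
  rewrite event_prob_harmonic -EFinM.
  rewrite -[LHS](expectation_at0 F (fun=> (\1_(B 0%N) x * h x)%:E) x).
  apply: eq_integral => w _; congr (_ * _)%:E.
  rewrite !indicE; congr ((_ : bool)%:R); apply/idP/idP => /set_mem xB; apply/mem_set.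
    by move=> [|].
  exact: (xB 0%N).
pose B' k := B k.+1.
have mB' k : measurable (B' k) by exact: mB.
have -> : box n.+1 B `&` A =
    [set t | B 0%N (t 0%N)] `&` (shiftn 1 @^-1` (box n B' `&` A)).
  rewrite preimage_setI hA setIA; congr (_ `&` _); apply/seteqP; split=> t.
    by move=> tB; split; [exact: (tB 0%N)|move=> k kn; exact: (tB k.+1)].
  by move=> [t0 tB] [|k] kn //; exact: tB.
have mbox : measurable (box n B' : set (seqspace (borel X))) by exact: measurable_box.
rewrite (Pr_from_markov hX hF); last exact: measurableI.
pose G (t : seqspace (borel X)) := (\1_(box n B') t * h (t n))%:E.
have G0 t : 0 <= G t by rewrite lee_fin mulr_ge0// event_prob_ge0.
have mG : measurable_fun setT G.
  apply/measurable_EFinP; apply: measurable_funM; first exact: measurable_indic.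
  exact: measurableT_comp measurable_event_prob (@measurable_coordinate _ (borel X) n).
rewrite (eq_integral
  (fun w => \int[P]_w' G (trajectory F (sds F x 1 w) w'))); last first.
  by move=> w _; rewrite IHn.
rewrite -(integral_markov hX hF)// -ge0_integralZl//; last first.
  have := measurableT_comp mG (measurable_shiftn (T := borel X) 1).
  by move=> /measurableT_comp/(_ (measurable_trajectory_at F hX x)).
apply: eq_integral => w _; rewrite /G -EFinM mulrA; congr (_ * _)%:E.
rewrite !indicE -natrM mulnb; congr ((_ : bool)%:R).
apply/andP/idP => [[/set_mem t0 /set_mem tB]|/set_mem tB].
  by apply/mem_set => -[|k] kn //; exact: tB.
by split; apply/mem_set; [exact: (tB 0%N)|move=> k kn; exact: (tB k.+1)].
Qed.

(** By harmonicity, the conditional variance of [h (X_1)] given [X_0 = x]. *)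
Definition event_prob_var (x : X) : \bar R :=
  \int[P]_w ((h (sds F x 1 w) - h x) ^+ 2)%:E.
Local Notation v := event_prob_var.

Lemma event_prob_var_ge0 x : 0 <= v x.
Proof. by apply: integral_ge0 => w _; rewrite lee_fin sqr_ge0. Qed.

Lemma measurable_event_incr : measurable_fun setT
  (fun z : borel X * Omega => ((h (sds F z.1 1 z.2) - h z.1) ^+ 2)%:E).
Proof.
apply/measurable_EFinP; apply: measurable_funX; apply: measurable_funB.
  exact: measurableT_comp measurable_event_prob (measurable_sds F hX 1).
exact: measurableT_comp measurable_event_prob measurable_fst.
Qed.

Lemma measurable_event_prob_var : measurable_fun setT (v : borel X -> \bar R).
Proof.
apply: (measurable_fun_fubini_tonelli_F (m2 := P)
  (fun z : borel X * Omega => ((h (sds F z.1 1 z.2) - h z.1) ^+ 2)%:E)).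
  exact: measurable_event_incr.
by move=> z; rewrite lee_fin sqr_ge0.
Qed.

Local Notation h2 := (fun x : X => (h x ^+ 2)%:E).

Let h2_ge0 x : 0 <= h2 x. Proof. by rewrite lee_fin sqr_ge0. Qed.
Let mh2 : measurable_fun setT (h2 : borel X -> \bar R).
Proof.
by apply/measurable_EFinP; apply: measurable_funX; exact: measurable_event_prob.
Qed.

Lemma event_prob_varE x : v x + h2 x = En 1 h2 x.
Proof.
have mh1 : measurable_fun setT (fun w => h (sds F x 1 w)).
  exact: measurableT_comp measurable_event_prob (measurable_sds_at F hX x 1).
have h0 := event_prob_ge0.
(* The extra term keeps all integrands non-negative, through [(a - b)^2 + 2 b a = a^2 + b^2]. *)
suff : v x + h2 x + h2 x = En 1 h2 x + h2 x.
  by move=> /(congr1 (fun y => y - h2 x)); rewrite !addeK.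
have -> : v x + h2 x + h2 x =
    \int[P]_w (((h (sds F x 1 w) - h x) ^+ 2)%:E + (2 * h x * h (sds F x 1 w))%:E).
  rewrite ge0_integralD//; last 4 first.
  - by move=> w _; rewrite lee_fin sqr_ge0.
  - by apply/measurable_EFinP; apply: measurable_funX; exact: measurable_funB.
  - by move=> w _; rewrite lee_fin !mulr_ge0.
  - by apply/measurable_EFinP; exact: measurable_funM.
  rewrite -addeA; congr (_ + _); under eq_integral do rewrite EFinM.
  rewrite ge0_integralZl//; last 3 first.
  - exact/measurable_EFinP.
  - by move=> w _; rewrite lee_fin.
  - by rewrite lee_fin mulr_ge0.
  by rewrite event_prob_harmonic -EFinM -EFinD; congr EFin; ring.
rewrite -[X in _ = _ + X](expectation_at0 F (fun=> h2 x) x) /expectation_at.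
rewrite -ge0_integralD//; last first.
  by apply/measurable_EFinP; exact: measurable_funX.
by apply: eq_integral => w _; rewrite -!EFinD; congr EFin; ring.
Qed.

(** By [event_prob_varE] the sum telescopes to [E h(X_N)^2 - h(x)^2]: the increments of a bounded
    martingale are square summable. *)
Lemma sum_event_prob_var x N : \sum_(n < N) En n v x <= 1.
Proof.
have sumE M : \sum_(n < M) En n v x + h2 x = En M h2 x.
  elim: M => [|M IH]; first by rewrite big_ord0 add0e expectation_at0.
  rewrite big_ord_recr /= addeAC IH (expectation_atSr hX hF)// addeC /expectation_at.
  rewrite -ge0_integralD//.
  - by apply: eq_integral => w _; exact: event_prob_varE.
  - by move=> w _; exact: event_prob_var_ge0.
  - exact: measurableT_comp measurable_event_prob_var (measurable_sds_at F hX x M).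
  - exact: measurableT_comp mh2 (measurable_sds_at F hX x M).
apply: (@le_trans _ _ (En N h2 x)); first by rewrite -sumE leeDl.
apply: (@le_trans _ _ (\int[P]_w 1%:E)); last first.
  by rewrite integral_cst// [X in (_ * X)](@probability_setT _ _ _ P) mule1.
apply: ge0_le_integral => //.
- exact: measurableT_comp mh2 (measurable_sds_at F hX x N).
- by move=> w _; rewrite lee_fin exprn_ile1 ?event_prob_ge0 ?event_prob_le1.
Qed.

(** Markov's inequality bounds the sum of the visit probabilities by [1/e], and Borel-Cantelli
    applies. *)
Lemma event_prob_var_finite_visits x (e : R) : (0 < e)%R ->
  Pr_from P F x (visits_io [set y : borel X | e%:E <= v y]) = 0.
Proof.
move=> e0; pose B := [set y : borel X | e%:E <= v y].
have mB : measurable B.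
  rewrite /B -[X in measurable X]setTI; apply: emeasurable_fun_c_infty => //.
  exact: measurable_event_prob_var.
pose S k := [set w | B (sds F x k w)].
have mS k : measurable (S k).
  by have := measurable_sds_at F hX x k measurableT mB; rewrite setTI.
have := @lim_sup_set_cvg0 _ _ _ P S mS; apply.
apply: (@le_lt_trans _ _ (e^-1)%:E); last exact: ltry.
apply: lime_le; first exact: is_cvg_nneseries.
apply: nearW => N; rewrite big_mkord.
rewrite -(@lee_pmul2l _ e%:E)//.
rewrite ge0_sume_distrr; last by move=> k _.
rewrite -EFinM divff ?gt_eqF//.
apply: le_trans (sum_event_prob_var x N); apply: lee_sum => k _.
apply: (@le_trans _ _ (\int[P]_w (e%:E * (\1_(S k) w)%:E))).
  rewrite ge0_integralZl//; last 2 first.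
  - by apply/measurable_EFinP; exact: measurable_indic.
  - by rewrite lee_fin ltW.
  by rewrite integral_indic// setIT.
apply: ge0_le_integral => //.
- by move=> w _; rewrite -EFinM lee_fin mulr_ge0// ltW.
- by apply: measurable_funeM; apply/measurable_EFinP; exact: measurable_indic.
- exact: measurableT_comp measurable_event_prob_var (measurable_sds_at F hX x k).
- move=> w _; rewrite indicE; have [wS|wS] := boolP (w \in S k).
    by rewrite mule1; exact: (set_mem wS).
  by rewrite mule0 event_prob_var_ge0.
Qed.

End invariant_event.

Section locally_finite.
Context (R : realType) (X : pmetricType R).
Hypothesis hX : proper_metric X.
Variable nu : {measure set (borel X) -> \bar R}.
Hypothesis nu_fin : forall K : set X, compact K -> (nu K < +oo)%E.

(** A fresh name for [nu], to which the sigma-finite structure demanded by Tonelli can be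
    attached. *)
Definition locally_finite_measure : set (borel X) -> \bar R := nu.

HB.instance Definition _ := Measure.on locally_finite_measure.

Let locally_finite_sigma_finite : sigma_finite setT locally_finite_measure.
Proof.
exists (fun n : nat => cball n%:R).
  exact/esym/bigcup_cball.
by move=> n; split; [exact: measurable_cball|apply: nu_fin; exact: hX].
Qed.

HB.instance Definition _ := @Measure_isSigmaFinite.Build _ (borel X) R
  locally_finite_measure locally_finite_sigma_finite.

Lemma locally_finite_is_sigma_finite :
  exists nu' : {sigma_finite_measure set (borel X) -> \bar R},
    nu' = nu :> (set (borel X) -> \bar R).
Proof. by exists locally_finite_measure. Qed.

End locally_finite.

(** * Triviality of invariant events *)

Section ergodicity.
Context (R : realType) (X : pmetricType R) (mu : probability (borel (cmap X)) R)
  (d : measure_display) (Omega : measurableType d) (P : probability Omega R)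
  (F : nat -> {RV P >-> borel (cmap X)}).
Hypothesis hX : proper_metric X.
Hypothesis hF : iid_with_law mu F.
Hypothesis hlc : locally_contractive P F.
Hypothesis hrec : recurrent P F.
Variable nu : {sigma_finite_measure set (borel X) -> \bar R}.
Hypothesis inv : forall U : set (borel X), measurable U ->
  nu U = (\int[nu]_x transition P F x U)%E.
Hypothesis nu_fin : forall K : set X, compact K -> (nu K < +oo)%E.
Hypothesis nuT : nu setT != 0%E.
Variable A : set (seqspace (borel X)).
Hypothesis mA : measurable A.
Hypothesis hA : shiftn 1 @^-1` A = A.
Local Open Scope ereal_scope.

Local Notation h := (event_prob F A).
Local Notation v := (event_prob_var F A).
Local Notation m := (path_law F hX nu).

Let minv := path_law_shift hX hF inv.
Let mh : measurable_fun setT (h : borel X -> R).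
Proof. exact: measurable_event_prob. Qed.
Let h0 x : (0 <= h x)%R. Proof. exact: event_prob_ge0. Qed.

(** By conservativity almost every path starting in this set returns infinitely often, yet almost no
    path visits it infinitely often. *)
Lemma event_prob_var_null (e : R) : (0 < e)%R ->
  nu [set y : borel X | e%:E <= v y] = 0.
Proof.
move=> e0; pose B := [set y : borel X | e%:E <= v y].
have mB : measurable B.
  rewrite /B -[X in measurable X]setTI; apply: emeasurable_fun_c_infty => //.
  exact: measurable_event_prob_var.
have mio := measurable_visits_io mB.
have io0 : m (visits_io B) = 0.
  rewrite path_lawE//; apply: integral0_eq => x _.
  exact: (event_prob_var_finite_visits hX hF mA hA x e0).
rewrite -(path_law_initial F hX nu mB).
apply/negligibleP; first exact: (@measurable_at _ (borel X)).
apply: (@negligibleS _ _ _ m (([set t | B (t 0%N)] `\` visits_io B) `|` visits_io B)).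
  by move=> t /= Bt; have [|nio] := pselect (visits_io B t); [right|left].
apply: negligibleU; last exact/negligibleP.
exact: (conservative minv (fun s : nat => measurable_cball s%:R)
  (path_law_cball_fin F hX nu_fin) (path_law_recurrent hX hrec nu) mB).
Qed.

Lemma event_prob_step : m.-negligible [set t | h (t 1%N) != h (t 0%N)].
Proof.
have mv := measurable_event_prob_var F hX mA.
have v0 := event_prob_var_ge0 F A.
have int_v : \int[nu]_x v x = 0.
  have : ae_eq nu setT v (cst 0).
    apply: (@negligibleS _ _ _ nu
      (\bigcup_j [set y : borel X | (j.+1%:R^-1)%:E <= v y])).
      move=> x /= /not_implyP[_ /eqP vx0].
      have : 0 < v x by rewrite lt0e vx0 v0.
      case vx : (v x) => [a| |]//; last by move=> _; exists 0%N => //=; rewrite vx leey.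
      rewrite lte_fin => a0.
      have [j _ /(_ j (leqnn j))/= ja] := near_infty_natSinv_lt (PosNum a0).
      by exists j => //=; rewrite vx lee_fin ltW.
    apply: negligible_bigcup => j; apply/negligibleP.
      rewrite -[X in measurable X]setTI; exact: emeasurable_fun_c_infty.
    exact: event_prob_var_null.
  move=> /(ge0_ae_eq_integral measurableT mv (measurable_cst 0)) ->//.
  by rewrite integral0.
pose G (t : seqspace (borel X)) : \bar R := ((h (t 1%N) - h (t 0%N)) ^+ 2)%:E.
have mG : measurable_fun setT G.
  apply/measurable_EFinP; apply: measurable_funX; apply: measurable_funB.
    exact: measurableT_comp mh (@measurable_coordinate _ (borel X) 1).
  exact: measurableT_comp mh (@measurable_coordinate _ (borel X) 0).
have : \int[m]_t `|G t| = 0.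
  under eq_integral do rewrite gee0_abs ?lee_fin ?sqr_ge0//.
  rewrite integral_path_law//; last by move=> t; rewrite lee_fin sqr_ge0.
  rewrite -int_v; rewrite /G /trajectory /=.
  rewrite (fubini_tonelli1 (fun z : borel X * Omega =>
    ((h (sds F z.1 1 z.2) - h z.1) ^+ 2)%:E))//.
    exact: measurable_event_incr.
  by move=> z; rewrite lee_fin sqr_ge0.
move=> /(ae_eq_integral_abs m measurableT mG); apply: negligibleS => t /= ht.
move=> /(_ I)/eqP; rewrite /G eqe sqrf_eq0 subr_eq0; exact/negP.
Qed.

(** The exceptional set of a single step has null preimages under all shifts, and off their union
    [h] never changes along the path. *)
Lemma event_prob_constant n : m.-negligible [set t | h (t n) != h (t 0%N)].
Proof.
have [N [mN N0 subN]] := event_prob_step.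
apply: (@negligibleS _ _ _ m (\bigcup_k shiftn k @^-1` N)); last first.
  apply: negligible_bigcup => k; apply/negligibleP.
    exact: measurable_shiftn_preimage.
  by rewrite -[RHS]N0; exact: measure_shiftn.
move=> t /= hn; apply: contrapT => nN.
have step k : h (t k.+1) = h (t k).
  apply/eqP/negPn/negP => hk; apply: nN; exists k => //.
  by apply: subN; rewrite /= /shiftn addn0 addn1.
by move: hn; elim: n => [|n IH]; rewrite ?eqxx// step.
Qed.

Let mcoord0 : measurable_fun setT (fun t : seqspace (borel X) => t 0%N : borel X).
Proof. exact: measurable_coordinate. Qed.

(** The measure [h dnu], realised as the initial distribution of the paths belonging to [A]. *)
Definition event_law : {measure set (borel X) -> \bar R} :=
  pushforward_measure
    (mrestr m mA) mcoord0.

Lemma integral_event_law (g : borel X -> \bar R) : measurable_fun setT g ->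
  (forall x, 0 <= g x) ->
  \int[event_law]_x g x = \int[nu]_x (g x * (h x)%:E).
Proof.
move=> mg g0.
have mgt : measurable_fun setT (fun t : seqspace (borel X) => g (t 0%N)).
  exact: measurableT_comp mg mcoord0.
transitivity (\int[mrestr m mA]_t g (t 0%N)).
  have := ge0_integral_pushforward mcoord0 (mrestr m mA) measurableT mg
    (fun t _ => g0 t).
  by rewrite preimage_setT.
transitivity (\int[m]_(t in A) g (t 0%N)).
  rewrite -(setUv A) ge0_integral_setU//; last 3 first.
  - exact: measurableC.
  - by rewrite setUv.
  - by rewrite disj_set2E setICr.
  rewrite [X in _ + X]null_set_integral ?adde0//; last 3 first.
  - exact: measurableC.
  - exact: measurable_funTS.
  - by change (m (~` A `&` A) = 0); rewrite setICl measure0.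
  apply: eq_measure_integral => B mB BA; rewrite /= /mrestr.
  by rewrite setIidl.
have mgA : measurable_fun setT (fun t : seqspace (borel X) => g (t 0%N) * (\1_A t)%:E).
  by apply: emeasurable_funM => //; apply/measurable_EFinP; exact: measurable_indic.
have gA0 (t : seqspace (borel X)) : 0 <= g (t 0%N) * (\1_A t)%:E.
  by rewrite mule_ge0// lee_fin.
rewrite integral_mkcond epatch_indic (integral_path_law F hX nu mgA gA0).
rewrite (fubini_tonelli1 (fun z : borel X * Omega =>
  g (trajectory F z.1 z.2 0%N) * (\1_A (trajectory F z.1 z.2))%:E))//; last first.
  exact: measurableT_comp mgA (measurable_trajectory F hX).
apply: eq_integral => x _; rewrite /fubini_F /=.
have mAx := measurable_trajectory_at F hX x measurableT mA.
rewrite setTI in mAx.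
rewrite (eq_integral (fun w => g x * (\1_(trajectory F x @^-1` A) w)%:E))//.
rewrite ge0_integralZl//; last first.
  by apply/measurable_EFinP; exact: measurable_indic.
by rewrite integral_indic// setIT -(event_probE F hX mA).
Qed.

(** By the Markov property the left-hand side integrates the indicator of the box times [h (X_n)].
    Replacing [h (X_n)] by [h (X_0)] turns [h] into a density of the starting point. *)
Lemma event_law_box n (B : nat -> set (borel X)) : (forall k, measurable (B k)) ->
  m (box n B `&` A) = \int[event_law]_x Pr_from P F x (box n B).
Proof.
move=> mB; have mbox : measurable (box n B : set (seqspace (borel X))).
  exact: measurable_box.
pose G k (t : seqspace (borel X)) : \bar R := (\1_(box n B) t * h (t k))%:E.
have mG k : measurable_fun setT (G k).
  apply/measurable_EFinP; apply: measurable_funM; first exact: measurable_indic.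
  exact: measurableT_comp mh (@measurable_coordinate _ (borel X) k).
have G0 k t : 0 <= G k t by rewrite lee_fin mulr_ge0.
have -> : m (box n B `&` A) = \int[m]_t G n t.
  rewrite path_lawE; last exact: measurableI.
  rewrite integral_path_law// (fubini_tonelli1 (G n \o (fun z : borel X * Omega =>
    trajectory F z.1 z.2 : seqspace (borel X))))//; last 2 first.
  - exact: measurableT_comp (mG n) (measurable_trajectory F hX).
  - by move=> z /=.
  by apply: eq_integral => x _; rewrite (event_box_markov hX hF mA hA).
have -> : \int[m]_t G n t = \int[m]_t G 0%N t.
  apply: ge0_ae_eq_integral => //.
  apply: negligibleS (event_prob_constant n) => t /= nG.
  by apply/eqP => hn; apply: nG => _; rewrite /G hn.
rewrite integral_event_law//; last 2 first.
- exact: measurable_Pr_from.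
- by move=> x; exact: Pr_from_ge0.
rewrite integral_path_law// (fubini_tonelli1 (G 0%N \o (fun z : borel X * Omega =>
    trajectory F z.1 z.2 : seqspace (borel X))))//; last 2 first.
- exact: measurableT_comp (mG 0%N) (measurable_trajectory F hX).
- by move=> z /=.
apply: eq_integral => x _; rewrite /fubini_F /G /=.
have mbx := measurable_trajectory_at F hX x measurableT mbox.
rewrite setTI in mbx.
rewrite (eq_integral (fun w => (\1_(trajectory F x @^-1` box n B) w)%:E * (h x)%:E))//.
rewrite ge0_integralZr//; last 2 first.
- by apply/measurable_EFinP; exact: measurable_indic.
- by rewrite lee_fin.
by rewrite integral_indic// setIT.
Qed.

Lemma event_lawE (U : set (borel X)) : event_law U = m ([set t | U (t 0%N)] `&` A).
Proof. by []. Qed.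

(** As [A] and the path law are shift invariant, [U] may be imposed at time [1] instead of [0];
    [event_law_box] then applies to a box constrained only there. *)
Lemma event_law_invariant (U : set (borel X)) : measurable U ->
  event_law U = \int[event_law]_x transition P F x U.
Proof.
move=> mU; pose B k : set (borel X) := if k is 1%N then U else setT.
have mB k : measurable (B k) by rewrite /B; case: k => [|[|k]].
have boxE : box 1 B = [set t | U (t 1%N)].
  by apply/seteqP; split=> [t tB|t tU [|[|k]]] //; exact: (tB 1%N).
have m0 : measurable [set t : seqspace (borel X) | U (t 0%N)].
  exact: (@measurable_at _ (borel X)).
transitivity (m (box 1 B `&` A)).
  rewrite event_lawE -(minv (measurableI _ _ m0 mA)) preimage_setI hA boxE.
  by congr (m (_ `&` _)).
rewrite event_law_box//; apply: eq_integral => x _.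
by rewrite /Pr_from /pushforward boxE.
Qed.

Lemma event_law_fin (K : set X) : compact K -> event_law K < +oo.
Proof.
move=> cK; have mK : measurable (K : set (borel X)).
  by apply: measurable_closed; apply: compact_closed => //; exact: metric_hausdorff.
apply: le_lt_trans (nu_fin cK).
rewrite event_lawE -(path_law_initial F hX nu mK).
have mK0 : measurable [set t : seqspace (borel X) | (K : set (borel X)) (t 0%N)].
  exact: (@measurable_at _ (borel X)).
by apply: le_measure; rewrite ?inE//; exact: measurableI.
Qed.

Theorem event_trivial : m A = 0 \/ m (~` A) = 0.
Proof.
have [el elE] := locally_finite_is_sigma_finite hX event_law_fin.
have el_inv (U : set (borel X)) : measurable U -> el U = \int[el]_x transition P F x U.
  by rewrite elE; exact: event_law_invariant.
have el_fin (K : set X) : compact K -> el K < +oo by rewrite elE; exact: event_law_fin.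
have [c c0 elc] := invariant_measure_unique hX hF hlc hrec inv nu_fin el_inv el_fin nuT.
rewrite elE in elc.
(* Proportionality of the initial laws lifts to boxes, hence to all events: this is independence
   from [A] in the form suited to an infinite measure. *)
have mAE (G : set (seqspace (borel X))) : measurable G -> m (G `&` A) = c%:E * m G.
  pose m1 : {measure set (seqspace (borel X)) -> \bar R} := mrestr m mA.
  pose m2 : {measure set (seqspace (borel X)) -> \bar R} := mscale (NngNum c0) m.
  apply: (@seqspace_measure_unique _ (borel X) R m1 m2 (fun n : nat => cball n%:R)).
  - by move=> k; exact: measurable_cball.
  - exact: bigcup_cball.
  - by move=> k; exact: event_law_fin (hX (x := point) (r := k%:R)).
  - move=> n B mB; change (m (box n B `&` A) = c%:E * m (box n B)).
    rewrite event_law_box// path_lawE; last exact: measurable_box.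
    pose m3 : {measure set (borel X) -> \bar R} := mscale (NngNum c0) nu.
    rewrite (@eq_measure_integral _ (borel X) R setT m3); last first.
      by move=> U mU _; exact: elc.
    rewrite ge0_integral_mscale//.
      by apply: measurable_Pr_from => //; exact: measurable_box.
    by move=> x _; exact: Pr_from_ge0.
have [k nuk] := cball_measure_neq0 nuT.
have mball := measurable_cball (X := X) (k%:R : R).
have fink : nu (cball k%:R) \is a fin_num.
  by rewrite ge0_fin_numE//; apply: nu_fin; exact: hX.
(* Taking for [G] the paths of [A] that start in the ball gives [c = c^2]; the ball has finite
   non-zero measure, so its factor can be cancelled. *)
have : c%:E * nu (cball k%:R) = c%:E * (c%:E * nu (cball k%:R)).
  rewrite -elc// event_lawE -mAE; last first.
    by apply: measurableI => //; exact: (@measurable_at _ (borel X)).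
  by rewrite -setIA setIid.
rewrite -(fineK fink) -!EFinM => -[cc].
have {}cc : (c * (1 - c) = 0)%R.
  have nk : (fine (nu (cball k%:R)) != 0)%R by rewrite fine_eq0.
  by apply: (mulIf nk); rewrite mul0r; lra.
have mT : measurable [set: seqspace (borel X)] by [].
move/eqP: cc; rewrite mulf_eq0 subr_eq0 => /orP[/eqP cz|/eqP c1].
  by left; have := mAE _ mT; rewrite setTI cz mul0e.
right; have := mAE _ (measurableC mA); rewrite setICl measure0 -c1 mul1e.
exact/esym.
Qed.

End ergodicity.

Theorem theorem2p13 (R : realType) (X : pmetricType R)
    (mu : probability (borel (cmap X)) R)
    (d : measure_display) (Omega : measurableType d) (P : probability Omega R)
    (F : nat -> {RV P >-> borel (cmap X)})
    (nu : {measure set (borel X) -> \bar R}) :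
  proper_metric X ->
  regular_measure mu ->
  iid_with_law mu F ->
  locally_contractive P F ->
  recurrent P F ->
  invariant_radon_measure P F nu ->
  (forall L : set X, is_attractor P F L ->
     ergodic (Pr_initial P F nu L) (@time_shift R X)) /\
  (forall nu' : {measure set (borel X) -> \bar R},
     invariant_radon_measure P F nu' ->
     exists c : R, 0 < c /\
       forall U : set (borel X), measurable U -> nu' U = (c%:E * nu U)%E).
Proof.
move=> hX _ hF hlc hrec [[nu_fin _] nuT nu_inv].
have [nuS nuSE] := locally_finite_is_sigma_finite hX nu_fin.
have nuS_fin (K : set X) : compact K -> (nuS K < +oo)%E by rewrite nuSE; exact: nu_fin.
have nuS_inv (U : set (borel X)) : measurable U ->
    nuS U = (\int[nuS]_x transition P F x U)%E.
  by rewrite nuSE; exact: nu_inv.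
have nuST : nuS setT != 0%E by rewrite nuSE.
split=> [L [clL _ _] A mA hA|nu' [[nu'_fin _] nu'T nu'_inv]].
  (* The integral over [L] is at most the integral over the whole space, so null events of
     [path_law] remain null. *)
  have Pr_initial0 (C : set (seqspace (borel X))) : measurable C ->
      path_law F hX nuS C = 0%E -> Pr_initial P F nu L C = 0%E.
    move=> mC; rewrite path_lawE// nuSE => C0.
    apply/eqP; rewrite eq_le; apply/andP; split; last first.
      by apply: integral_ge0 => x _; exact: Pr_from_ge0.
    rewrite -C0 /Pr_initial; apply: ge0_subset_integral => //.
    - exact: measurable_closed.
    - exact: measurable_Pr_from.
    - by move=> x _; exact: Pr_from_ge0.
  have [A0|A0] := event_trivial hX hF hlc hrec nuS_inv nuS_fin nuST mA hA.
    by left; exact: Pr_initial0.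
  by right; apply: Pr_initial0 A0; exact: (@measurableC _ (seqspace (borel X))).
have [nuS' nuS'E] := locally_finite_is_sigma_finite hX nu'_fin.
have nuS'_fin (K : set X) : compact K -> (nuS' K < +oo)%E.
  by rewrite nuS'E; exact: nu'_fin.
have nuS'_inv (U : set (borel X)) : measurable U ->
    nuS' U = (\int[nuS']_x transition P F x U)%E.
  by rewrite nuS'E; exact: nu'_inv.
have [c c0 cE] := invariant_measure_unique hX hF hlc hrec nuS_inv nuS_fin
  nuS'_inv nuS'_fin nuST.
rewrite nuSE nuS'E in cE; exists c; split => //.
(* A zero constant would make [nu'] vanish. *)
rewrite lt_neqAle c0 andbT eq_sym; apply: contra nu'T => /eqP cz.
by rewrite cE// cz mul0e.
Qed.
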